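(* There exist an absolute constant $c>0$ and functions $C:[1,2)\to(0,\infty)$ with $C(p)\ge c\,(2-p)$ and $C':[1,2]\to(0,\infty)$ with $C'(p)\ge c$ such that the following hold for every $n\ge1$. (i) For every $A\in M_2(\mathbb{C})^{\otimes n}$ with $\|A\|_{\infty}\leq 1$ and every $1\le p<2$, $$\mathcal{E}_p[A] \geq C(p)\, \mathrm{Var}(A) \left[1+\frac{1}{2}\ln^{+} \left(\frac{1}{\sum_{j=1}^n\mathrm{Inf}_j^{1}[A]^2}\right)\right]^{p/2}.$$ (ii) For every quantum Boolean function $A\in M_2(\mathbb{C})^{\otimes n}$ (that is, $A^*=A$ and $A^2=\mathbf 1$) and every $1\le p\le 2$, $$\mathcal{E}_p[A] \geq C'(p)\, \mathrm{Var}(A) \left[1+\frac{1}{2}\ln^{+} \left(\frac{1}{\sum_{j=1}^n\mathrm{Inf}_j^{1}[A]^2}\right)\right]^{p/2}.$$ Here, if $\mathrm{Var}(A)=0$, the right-hand sides are understood to equal $0$.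
   Context: On $M_2(\mathbb{C})^{\otimes n}\cong M_{2^n}(\mathbb{C})$ let $\tau=2^{-n}\mathrm{tr}$ be the normalized trace, $|A|=(A^*A)^{1/2}$, $\|A\|_p=\tau(|A|^p)^{1/p}$ for $1\le p<\infty$, and $\|A\|_\infty$ the operator norm. $\mathrm{Var}(A)=\|A-\tau(A)\mathbf 1\|_2^2$. For $j\in[n]=\{1,\dots,n\}$, $\tau_j$ is the map acting as $\frac12\mathrm{tr}(\cdot)\mathbf 1$ on the $j$-th tensor factor and as the identity on the other factors, and $d_j A=A-\tau_j(A)$. Let $|\nabla A|=\left(\sum_{j=1}^n|d_jA|^2\right)^{1/2}$, $\mathcal{E}_p[A]=\||\nabla A|\|_p^p$ and $\mathrm{Inf}_j^1[A]=\|d_jA\|_1$. $\ln^+(x)=\max\{\ln x,0\}$. *)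

(* Defs.v *)
From HB Require Import structures.
From mathcomp Require Import all_boot all_order all_algebra.
From mathcomp Require Import complex.
From mathcomp Require Import all_classical all_reals all_analysis.

Set Implicit Arguments.
Unset Strict Implicit.
Unset Printing Implicit Defensive.

Import Order.TTheory GRing.Theory Num.Theory.

Local Open Scope classical_set_scope.
Local Open Scope sesquilinear_scope.
Local Open Scope complex_scope.
Local Open Scope ring_scope.

(* The standard basis of (C^2)^{(x) n} is indexed by the words of length n over
   {0, 1}; words are turned into matrix indices by enum_val and enum_rank. *)
Definition word (n : nat) := {ffun 'I_n -> 'I_2}.

Definition qdim (n : nat) : nat := #|{: word n}|.

Lemma qdimE n : qdim n = (2 ^ n)%N.
Proof. by rewrite /qdim card_ffun !card_ord. Qed.

Definition qmx (R : realType) (n : nat) := 'M[R[i]]_(qdim n).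

Definition entry (R : realType) n (A : qmx R n) (x y : word n) : R[i] :=
  A (enum_rank x) (enum_rank y).

Definition qmx_of (R : realType) n (f : word n -> word n -> R[i]) : qmx R n :=
  \matrix_(a, b) f (enum_val a) (enum_val b).

Lemma entry_qmx_of (R : realType) n (f : word n -> word n -> R[i]) x y :
  entry (qmx_of f) x y = f x y.
Proof. by rewrite /entry mxE !enum_rankK. Qed.

Definition tensor (R : realType) n (a : 'I_n -> 'M[R[i]]_2) : qmx R n :=
  qmx_of (fun x y => \prod_j a j (x j) (y j)).

Definition setbit n (j : 'I_n) (x : word n) (b : 'I_2) : word n :=
  [ffun k => if k == j then b else x k].

Definition ntr (R : realType) n (A : qmx R n) : R[i] :=
  (2 ^+ n)^-1 * \tr A.

(* The conditional trace tau_j; tau_tensor below checks it on product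
   matrices, which span the whole algebra. *)
Definition tau (R : realType) n (j : 'I_n) (A : qmx R n) : qmx R n :=
  qmx_of (fun x y =>
    if x j == y j then 2^-1 * \sum_(b < 2) entry A (setbit j x b) (setbit j y b)
    else 0).

Lemma tau_tensor (R : realType) n (j : 'I_n) (a : 'I_n -> 'M[R[i]]_2) :
  tau j (tensor a) =
  tensor (fun k => if k == j then (2^-1 * \tr (a j))%:M else a k).
Proof.
apply/matrixP => u v; rewrite !mxE [in RHS](bigD1 j) //= eqxx !mxE.
case: eqVneq => [_|_]; last by rewrite mulr0n mul0r.
rewrite mulr1n -mulrA; congr (_ * _); rewrite /mxtrace mulr_suml.
apply: eq_bigr => b _; rewrite entry_qmx_of (bigD1 j) //= !ffunE eqxx.
by congr (_ * _); apply: eq_bigr => k /negPf kj; rewrite !ffunE kj.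
Qed.

Definition dd (R : realType) n (j : 'I_n) (A : qmx R n) : qmx R n :=
  A - tau j A.

(* Functional calculus of a Hermitian matrix H: f is applied to the (real)
   eigenvalues in a spectral decomposition H = P^-1 diag(l) P, P unitary. *)
Definition hermfun (R : realType) m (f : R -> R) (H : 'M[R[i]]_m) :
    'M[R[i]]_m :=
  invmx (spectralmx H)
    *m diag_mx (map_mx (fun z : R[i] => (f (complex.Re z))%:C) (spectral_diag H))
    *m spectralmx H.

Lemma hermfun_id (R : realType) m (H : 'M[R[i]]_m) :
  H ^t* = H -> hermfun id H = H.
Proof.
move=> Hh; have Hherm : H \is hermsymmx.
  by apply/is_hermitianmxP; rewrite expr0 scale1r Hh.
have Hn : H \is normalmx by apply: hermitian_normalmx.
rewrite {2}(orthomx_spectralP Hn) /hermfun; congr (_ *m diag_mx _ *m _).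
apply/rowP => j; rewrite mxE; apply: RRe_real.
by move/mxOverP: (hermitian_spectral_diag_real Hherm); apply.
Qed.

Definition absmx (R : realType) m (A : 'M[R[i]]_m) : 'M[R[i]]_m :=
  hermfun Num.sqrt (A ^t* *m A).

Definition lpnorm (R : realType) n (p : R) (A : qmx R n) : R :=
  complex.Re (ntr (hermfun (fun t => t `^ p) (absmx A))) `^ p^-1.

Definition euclnorm (R : realType) m (v : 'cV[R[i]]_m) : R :=
  Num.sqrt (\sum_i complex.Re (`|v i 0| ^+ 2)).

Definition opnorm (R : realType) m (A : 'M[R[i]]_m) : R :=
  sup [set euclnorm (A *m v) | v in [set v : 'cV[R[i]]_m | euclnorm v = 1]].

Definition variance (R : realType) n (A : qmx R n) : R :=
  lpnorm 2 (A - (ntr A)%:M) ^+ 2.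

Definition gradabs (R : realType) n (A : qmx R n) : qmx R n :=
  hermfun Num.sqrt (\sum_(j < n) absmx (dd j A) *m absmx (dd j A)).

Definition energy (R : realType) n (p : R) (A : qmx R n) : R :=
  lpnorm p (gradabs A) `^ p.

Definition influence1 (R : realType) n (j : 'I_n) (A : qmx R n) : R :=
  lpnorm 1 (dd j A).

Definition lnp (R : realType) (x : R) : R := Num.max (ln x) 0.

Definition quantum_boolean (R : realType) n (A : qmx R n) : Prop :=
  A ^t* = A /\ A *m A = 1%:M.

(* When the sum of squared influences is 0, every d_j A vanishes, hence so does
   the variance; as 1 / 0 = 0 and ln 0 = 0 the bound is then 0. *)
Definition talagrand_rhs (R : realType) n (K p : R) (A : qmx R n) : R :=
  K * variance A *
  (1 + 2^-1 * lnp (1 / \sum_(j < n) influence1 j A ^+ 2)) `^ (p / 2).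

(* Main.v *)
Require Import Defs.
From mathcomp Require Import all_boot all_order all_algebra.
From mathcomp Require Import complex.
From mathcomp Require Import all_classical all_reals all_analysis.
From mathcomp Require Import ring lra.

(** Write tau_j for the conditional traces, d_j = 1 - tau_j and
P_r = prod_j (tau_j + r d_j) for the depolarising semigroup, r in [0, 1].
Since the tau_j are commuting self-adjoint projections,
w(r) = tr (A* P_r A) is a polynomial in r with nonnegative coefficients; the
coefficient of r^k is the mass of A at level k, and
r w'(r) = sum_j tr ((d_j A)* d_j P_r A).  Up to the factor 2^-n, which is
left out below, w(1) - w(0) is the variance.

Upper bound by the energy.  When A* A <= 1, applying the Kadison-Schwarz
inequality one site at a time ([smooth_gradient]) gives the pointwise bound
sum_j |d_j P_r A|^2 <= K with K = r / (1 - r).  Pair the columns (d_j A)_j and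
(d_j P_r A)_j in an eigenbasis of |grad A|^2, with eigenvalues g_i^2: each
basis vector contributes at most g_i y_i with y_i^2 <= K, hence at most
y_i^2 / 2 + K^(1 - p/2) g_i^p.  The y_i^2 add up to r^2 w'(r^2) <= r w'(r),
which is absorbed on the left, so r w'(r) <= 2 K^(1 - p/2) tr |grad A|^p
([heat_energy]).  Integrating from r = 1 - 1/(2d) to 1 bounds the mass of A
above level d by a constant times d^(-p/2) times the energy, uniformly in p
in [1, 2] ([heat_tail]).  The case d = 1 is a Poincare inequality.

Small mass at low levels.  The semigroup is hypercontractive: the fourth norm
of P_(1/3) X is at most the second norm of X ([hypercontractive]).  Dually
tr (X* P_(1/9) X) <= ||X||_1 ||X||_2 ([heat_hyper]).  Applied to X = P_(1/2) d_j A and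
summed over j by Cauchy-Schwarz, it bounds the mass at low levels by
sqrt (M Var A), where M is the sum of the squared influences
([low_le_influence]); applied to A - tau(A) it bounds it by
||A - tau(A)||_1 ||A - tau(A)||_2.  If this is at most b Var A, then a cutoff d
of order ln (1/b) makes the mass below d at most half of the variance, so that
the energy is at least a constant times Var(A) (1 + ln (1/b))^(p/2)
([energy_ge_log]).

Three cases finish the proof.  If M <= Var(A)^2, take b = M^(1/4).
Otherwise ln (1/M) <= 2 ln (1/Var A), and it suffices to find a power of the
variance for b.  For a quantum Boolean function
||A - tau(A)||_1 = Var A, because |A - tau(A)| = 1 - tau(A) A; so
b = Var(A)^(1/2) works.  For a contraction put k = (2 - p)/8.  Either
||A - tau(A)||_1 <= Var(A)^(1/2 + k) and b = Var(A)^k works, or the L^1 Poincare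
inequality ||A - tau(A)||_1 <= 4 || |grad A| ||_1 ([l1_poincare]) bounds
the energy from below by a power of the variance with exponent less than 1 by
an amount of order 2 - p, which beats the logarithm.  Both alternatives cost a
factor of order 2 - p. *)

Set Implicit Arguments.
Unset Strict Implicit.
Unset Printing Implicit Defensive.

Import Order.TTheory GRing.Theory Num.Theory.

Local Open Scope classical_set_scope.
Local Open Scope sesquilinear_scope.
Local Open Scope complex_scope.
Local Open Scope ring_scope.

(** * Complex scalars, adjoints and real traces *)

(** The linear algebra needs only an algebraically closed field with a conjugation
whose real part takes values in R; complex numbers over R are one instance. *)
Record cplx (R : realType) := Cplx {
  ccarrier :> numClosedFieldType;
  re : ccarrier -> R;
  emb : {rmorphism R -> ccarrier};
  reE : forall z, emb (re z) = 'Re z;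
  embK : forall r, re (emb r) = r }.
Arguments emb {R c}.
Local Notation "r %:K" := (emb r) (at level 1, format "r %:K").

Section Adjoint.
Variables (R : realType) (C : cplx R).

Lemma emb_inj : injective (emb : R -> C).
Proof. exact: fmorph_inj. Qed.

Lemma embRe (r : R) : 'Re (r%:K : C) = r%:K.
Proof. by rewrite -reE embK. Qed.

Lemma embJ (r : R) : Num.conj (r%:K : C) = r%:K.
Proof. by apply/CrealP; rewrite -embRe Creal_Re. Qed.

Lemma emb_real (r : R) : (r%:K : C) \is Num.real.
Proof. by apply/CrealP; exact: embJ. Qed.

Lemma emb_ge0 (r : R) : (0 <= (r%:K : C)) = (0 <= r).
Proof.
have H s : 0 <= s -> 0 <= (s%:K : C).
  by move=> /sqr_sqrtr <-; rewrite rmorphXn /= real_exprn_even_ge0 ?emb_real.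
apply/idP/idP => [h|]; last exact: H.
rewrite leNgt; apply/negP => r0.
have : 0 <= ((- r)%:K : C) by apply: H; rewrite oppr_ge0 ltW.
rewrite rmorphN oppr_ge0 => h'.
have /eqP : (r%:K : C) = 0 by apply/le_anti; rewrite h h'.
by rewrite fmorph_eq0 lt_eqF.
Qed.

Lemma reD (x y : C) : re (x + y) = re x + re y.
Proof. by apply: emb_inj; rewrite rmorphD !reE raddfD. Qed.

Lemma reN (x : C) : re (- x) = - re x.
Proof. by apply: emb_inj; rewrite rmorphN !reE raddfN. Qed.

Lemma re0 : re (0 : C) = 0.
Proof. by rewrite -(rmorph0 emb) embK. Qed.

Lemma reZ (r : R) (z : C) : re (r%:K * z) = r * re z.
Proof. by apply: emb_inj; rewrite rmorphM /= !reE ReMl ?emb_real. Qed.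

Lemma re_sum (I : finType) (P : pred I) (F : I -> C) :
  re (\sum_(i | P i) F i) = \sum_(i | P i) re (F i).
Proof. by apply: big_morph; [exact: reD | exact: re0]. Qed.

Lemma reJ (z : C) : re (Num.conj z) = re z.
Proof. by apply: emb_inj; rewrite !reE Re_conj. Qed.

Lemma reMJ (z : C) : 0 <= re (Num.conj z * z).
Proof.
by rewrite -emb_ge0 reE mulrC -normCK (Creal_ReP _ _) ?ger0_real ?exprn_ge0.
Qed.

Lemma sqr_re_le (z : C) : re z ^+ 2 <= re (Num.conj z * z).
Proof.
rewrite -subr_ge0 -emb_ge0 rmorphB rmorphXn /= !reE mulrC -normCK.
rewrite (Creal_ReP _ _) ?ger0_real ?exprn_ge0 // normC2_Re_Im addrAC subrr add0r.
by rewrite real_exprn_even_ge0 ?Creal_Im.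
Qed.

Lemma ctM m n p (A : 'M[C]_(m, n)) (B : 'M[C]_(n, p)) :
  (A *m B) ^t* = B ^t* *m A ^t*.
Proof. by rewrite trmx_mul map_mxM. Qed.

Lemma ctD m n (A B : 'M[C]_(m, n)) : (A + B) ^t* = A ^t* + B ^t*.
Proof. by rewrite raddfD /= map_mxD. Qed.

Lemma ctN m n (A : 'M[C]_(m, n)) : (- A) ^t* = - A ^t*.
Proof. by rewrite raddfN /= map_mxN. Qed.

Lemma ctB m n (A B : 'M[C]_(m, n)) : (A - B) ^t* = A ^t* - B ^t*.
Proof. by rewrite ctD ctN. Qed.

Lemma ct1 m : (1%:M : 'M[C]_m) ^t* = 1%:M.
Proof. by rewrite trmx1 map_mx1. Qed.

Lemma ctZ m n (r : R) (A : 'M[C]_(m, n)) : (r%:K *: A) ^t* = r%:K *: A ^t*.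
Proof. by apply/matrixP => i j; rewrite !mxE rmorphM /= embJ. Qed.

Lemma ct_sum m n (I : finType) (F : I -> 'M[C]_(m, n)) :
  (\sum_i F i) ^t* = \sum_i (F i) ^t*.
Proof. by rewrite raddf_sum /= map_mx_sum. Qed.

Lemma addmxE p q (A B : 'M[C]_(p, q)) (i : 'I_p) (j : 'I_q) : (A + B) i j = A i j + B i j.
Proof. by rewrite mxE. Qed.

Lemma oppmxE p q (A : 'M[C]_(p, q)) (i : 'I_p) (j : 'I_q) : (- A) i j = - A i j.
Proof. by rewrite mxE. Qed.

Lemma scalemxE p q (c : C) (A : 'M[C]_(p, q)) (i : 'I_p) (j : 'I_q) : (c *: A) i j = c * A i j.
Proof. by rewrite mxE. Qed.

Definition retr m (A : 'M[C]_m) : R := re (\tr A).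

Lemma retrD m (A B : 'M[C]_m) : retr (A + B) = retr A + retr B.
Proof. by rewrite /retr mxtraceD reD. Qed.

Lemma retrN m (A : 'M[C]_m) : retr (- A) = - retr A.
Proof. by rewrite /retr raddfN /= reN. Qed.

Lemma retrB m (A B : 'M[C]_m) : retr (A - B) = retr A - retr B.
Proof. by rewrite retrD retrN. Qed.

Lemma retrZ m (r : R) (A : 'M[C]_m) : retr (r%:K *: A) = r * retr A.
Proof. by rewrite /retr mxtraceZ reZ. Qed.

Lemma retr_sum m (I : finType) (P : pred I) (F : I -> 'M[C]_m) :
  retr (\sum_(i | P i) F i) = \sum_(i | P i) retr (F i).
Proof. by apply: big_morph => [A B|]; [exact: retrD | rewrite /retr mxtrace0 re0]. Qed.

Lemma retrC m n (A : 'M[C]_(m, n)) (B : 'M[C]_(n, m)) :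
  retr (A *m B) = retr (B *m A).
Proof. by rewrite /retr mxtrace_mulC. Qed.

Lemma retr_ct m (A : 'M[C]_m) : retr (A ^t*) = retr A.
Proof.
rewrite /retr /mxtrace !re_sum; apply: eq_bigr => i _.
by rewrite !mxE reJ.
Qed.

Lemma retr_ge0 m n (A : 'M[C]_(m, n)) : 0 <= retr (A ^t* *m A).
Proof.
rewrite /retr /mxtrace re_sum; apply: sumr_ge0 => i _.
rewrite mxE re_sum; apply: sumr_ge0 => j _.
by rewrite !mxE reMJ.
Qed.

Lemma retr1 m : retr (1%:M : 'M[C]_m) = m%:R.
Proof.
by rewrite /retr mxtrace1 -(rmorph_nat emb) embK.
Qed.

End Adjoint.

Ltac mxring :=
  apply/matrixP => ? ?; rewrite ?(addmxE, oppmxE, scalemxE); ring.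

(** Distinct keys for the three site operations, so that no comparison of two
different ones ever unfolds them. *)
Fact cexp_key : unit. Proof. exact: tt. Qed.
Fact cdif_key : unit. Proof. exact: tt. Qed.
Fact depol_key : unit. Proof. exact: tt. Qed.

(** * Quadratic forms and unitary diagonalisation *)

Section Quad.
Variables (R : realType) (C : cplx R).

Lemma discr_le (a b c : R) : 0 <= c ->
  (forall x, 0 <= a - 2 * x * b + x ^+ 2 * c) -> b ^+ 2 <= a * c.
Proof.
move=> c0 H; have [cE|cN] := eqVneq c 0.
  rewrite cE mulr0; have [->|bN] := eqVneq b 0; first by rewrite expr0n.
  have := H ((a + 1) / (2 * b)).
  rewrite cE mulr0 addr0.
  have -> : a - 2 * ((a + 1) / (2 * b)) * b = -1 by field.
  by rewrite oppr_ge0 leNgt ltr01.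
have cp : 0 < c by rewrite lt_def cN.
have := H (b / c).
have -> : a - 2 * (b / c) * b + (b / c) ^+ 2 * c = (a * c - b ^+ 2) / c by field.
by rewrite pmulr_lge0 ?invr_gt0 // subr_ge0.
Qed.

Lemma cauchy_schwarz_sq (I : finType) m n (X Y : I -> 'M[C]_(m, n)) :
  (\sum_j retr ((X j) ^t* *m Y j)) ^+ 2 <=
  (\sum_j retr ((X j) ^t* *m X j)) * (\sum_j retr ((Y j) ^t* *m Y j)).
Proof.
apply: discr_le => [|x]; first by apply: sumr_ge0 => j _; exact: retr_ge0.
have -> : \sum_j retr ((X j) ^t* *m X j)
    - 2 * x * (\sum_j retr ((X j) ^t* *m Y j))
    + x ^+ 2 * (\sum_j retr ((Y j) ^t* *m Y j)) =
    \sum_j retr ((X j - x%:K *: Y j) ^t* *m (X j - x%:K *: Y j)).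
  rewrite !mulr_sumr -sumrN -!big_split /=; apply: eq_bigr => j _.
  rewrite ctB ctZ mulmxBl !mulmxBr -!scalemxAl -!scalemxAr !retrB !retrZ.
  rewrite -[retr ((Y j) ^t* *m X j)]retr_ct ctM trmxCK.
  by ring.
by apply: sumr_ge0 => j _; exact: retr_ge0.
Qed.

Lemma cauchy_schwarz (I : finType) m n (X Y : I -> 'M[C]_(m, n)) :
  \sum_j retr ((X j) ^t* *m Y j) <=
  Num.sqrt (\sum_j retr ((X j) ^t* *m X j)) *
  Num.sqrt (\sum_j retr ((Y j) ^t* *m Y j)).
Proof.
rewrite -sqrtrM; last by apply: sumr_ge0 => j _; exact: retr_ge0.
apply: le_trans (ler_norm _) _.
by rewrite -sqrtr_sqr ler_wsqrtr ?cauchy_schwarz_sq.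
Qed.

Lemma cauchy_schwarz1 m n (X Y : 'M[C]_(m, n)) :
  (retr (X ^t* *m Y)) ^+ 2 <= retr (X ^t* *m X) * retr (Y ^t* *m Y).
Proof.
have := @cauchy_schwarz_sq 'I_1 m n (fun=> X) (fun=> Y).
by rewrite !big_ord_recl !big_ord0 !addr0.
Qed.

Definition quad m (H : 'M[C]_m) (u : 'cV[C]_m) : R := retr (u ^t* *m H *m u).

(** Only the real part of the form is constrained: this is positivity of the Hermitian
part, which is what order comparisons of A* A and the like require. *)
Definition psd m (H : 'M[C]_m) := forall u, 0 <= quad H u.

Lemma quadD m (H K : 'M[C]_m) u : quad (H + K) u = quad H u + quad K u.
Proof. by rewrite /quad mulmxDr mulmxDl retrD. Qed.

Lemma quadB m (H K : 'M[C]_m) u : quad (H - K) u = quad H u - quad K u.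
Proof. by rewrite /quad mulmxBr mulmxBl retrB. Qed.

Lemma quadZ m (r : R) (H : 'M[C]_m) u : quad (r%:K *: H) u = r * quad H u.
Proof. by rewrite /quad -scalemxAr -scalemxAl retrZ. Qed.

Lemma quad_sum m (I : finType) (P : pred I) (F : I -> 'M[C]_m) u :
  quad (\sum_(i | P i) F i) u = \sum_(i | P i) quad (F i) u.
Proof. by rewrite /quad mulmx_sumr mulmx_suml retr_sum. Qed.

Lemma quadM m (X Y : 'M[C]_m) u :
  quad (X ^t* *m Y) u = retr ((X *m u) ^t* *m (Y *m u)).
Proof. by rewrite /quad ctM !mulmxA. Qed.

Lemma quad_conj m (X H : 'M[C]_m) u : quad (X ^t* *m H *m X) u = quad H (X *m u).
Proof. by rewrite /quad ctM !mulmxA. Qed.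

Lemma psd0 m : psd (0 : 'M[C]_m).
Proof. by move=> u; rewrite /quad mulmx0 mul0mx /retr mxtrace0 re0. Qed.

Lemma psdD m (H K : 'M[C]_m) : psd H -> psd K -> psd (H + K).
Proof. by move=> h k u; rewrite quadD; apply: addr_ge0. Qed.

Lemma psdZ m (r : R) (H : 'M[C]_m) : 0 <= r -> psd H -> psd (r%:K *: H).
Proof. by move=> r0 h u; rewrite quadZ; apply: mulr_ge0. Qed.

Lemma psd_sum m (I : finType) (P : pred I) (F : I -> 'M[C]_m) :
  (forall i, P i -> psd (F i)) -> psd (\sum_(i | P i) F i).
Proof. by move=> h u; rewrite quad_sum; apply: sumr_ge0 => i Pi; exact: h. Qed.

Lemma psd_sq m (X : 'M[C]_m) : psd (X ^t* *m X).
Proof. by move=> u; rewrite quadM; exact: retr_ge0. Qed.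

Lemma psd_conj m (X H : 'M[C]_m) : psd H -> psd (X ^t* *m H *m X).
Proof. by move=> h u; rewrite quad_conj; exact: h. Qed.

Definition udiag m (U : 'M[C]_m) (d : 'I_m -> R) : 'M[C]_m :=
  U ^t* *m diag_mx (\row_i (d i)%:K) *m U.

Definition eigvec m (U : 'M[C]_m) (i : 'I_m) : 'cV[C]_m := (row i U) ^t*.

Lemma ct_udiag m (U : 'M[C]_m) d : (udiag U d) ^t* = udiag U d.
Proof.
rewrite /udiag !ctM trmxCK !mulmxA; congr (_ *m _ *m _).
apply/matrixP => i j; rewrite !mxE rmorphMn /= embJ eq_sym.
by case: eqVneq => [->|].
Qed.

Lemma unitary_ctK m (U : 'M[C]_m) : U \is unitarymx -> U ^t* *m U = 1%:M.
Proof.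
by move=> Uu; rewrite -invmx_unitary // mulVmx // unitarymx_unit.
Qed.

Lemma udiagM m (U : 'M[C]_m) d e : U \is unitarymx ->
  udiag U d *m udiag U e = udiag U (fun i => d i * e i).
Proof.
move=> /unitarymxP UU; rewrite /udiag !mulmxA; congr (_ *m _).
rewrite -(mulmxA _ U) UU mulmx1 -mulmxA; congr (_ *m _).
rewrite mulmx_diag; congr diag_mx; apply/rowP => i.
by rewrite !mxE rmorphM.
Qed.

Lemma retr_udiag m (U : 'M[C]_m) d : U \is unitarymx ->
  retr (udiag U d) = \sum_i d i.
Proof.
move=> /unitarymxP UU; rewrite /udiag retrC mulmxA UU mul1mx /retr mxtrace_diag.
by rewrite re_sum; apply: eq_bigr => i _; rewrite mxE embK.
Qed.

Lemma udiagE m (U : 'M[C]_m) d e : d =1 e -> udiag U d = udiag U e.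
Proof.
by move=> de; rewrite /udiag; congr (_ *m diag_mx _ *m _); apply/rowP => i; rewrite !mxE de.
Qed.

Lemma spectral_udiag m (H : 'M[C]_m) : H ^t* = H ->
  H = udiag (spectralmx H) (fun i => re (spectral_diag H 0 i)).
Proof.
move=> Hh; have Hherm : H \is hermsymmx.
  by apply/is_hermitianmxP; rewrite expr0 scale1r Hh.
rewrite {1}(orthomx_spectralP (hermitian_normalmx Hherm)).
rewrite invmx_unitary ?spectral_unitarymx // /udiag.
congr (_ *m diag_mx _ *m _); apply/rowP => j; rewrite mxE reE.
have /mxOverP hr := hermitian_spectral_diag_real Hherm.
by rewrite (Creal_ReP _ (hr 0 j)).
Qed.

(** The functional calculus does not depend on the diagonalisation: the unitary
transition matrix W satisfies W_ij (d_j - e_i) = 0, so wherever W_ij is nonzero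
the eigenvalues agree, and then so do their images under f. *)
Lemma udiag_fun m (U V : 'M[C]_m) d e (f : R -> R) :
  U \is unitarymx -> V \is unitarymx -> udiag U d = udiag V e ->
  udiag V (f \o e) = udiag U (f \o d).
Proof.
move=> Uu Vu He; have VV := unitarymxP Vu; have UU := unitarymxP Uu.
have W i j : (V *m U ^t*) i j * (d j)%:K = (e i)%:K * (V *m U ^t*) i j.
  have := congr1 (fun H => V *m H *m U ^t*) He.
  rewrite /udiag !mulmxA VV mul1mx -[LHS]mulmxA UU mulmx1.
  rewrite -[in RHS]mulmxA => /matrixP/(_ i j).
  by rewrite mul_mx_diag mul_diag_mx !mxE.
suff E : V *m udiag V (f \o e) *m U ^t* = V *m udiag U (f \o d) *m U ^t*.
  move: (udiag V _) (udiag U _) E => X Y /(congr1 (fun Z => V ^t* *m Z *m U)).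
  rewrite /= !mulmxA !(unitary_ctK Vu) !mul1mx -!mulmxA.
  by rewrite !(unitary_ctK Uu) !mulmx1.
rewrite /udiag !mulmxA VV mul1mx -[RHS]mulmxA UU mulmx1 -mulmxA.
apply/matrixP => i j; rewrite mul_mx_diag mul_diag_mx !mxE /=.
have := W i j; rewrite mxE; set w := \sum_k _.
have [->|w0] := eqVneq w 0; first by rewrite !mulr0 !mul0r.
rewrite mulrC => /(mulIf w0) /emb_inj ->.
by rewrite mulrC.
Qed.

Lemma quad_eigvec m (U : 'M[C]_m) (M : 'M[C]_m) i :
  quad M (eigvec U i) = re ((U *m M *m U ^t*) i i).
Proof.
rewrite /quad /eigvec trmxCK /retr /mxtrace big_ord1; congr re.
by rewrite -row_mul !mxE; apply: eq_bigr => k _; rewrite !mxE.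
Qed.

Lemma sum_quad_eigvec m (U : 'M[C]_m) M : U \is unitarymx ->
  \sum_i quad M (eigvec U i) = retr M.
Proof.
move=> Uu; under eq_bigr do rewrite quad_eigvec.
rewrite -re_sum -/(mxtrace _) -/(retr _).
by rewrite retrC mulmxA unitary_ctK // mul1mx.
Qed.

Lemma quad_udiag m (U : 'M[C]_m) d i : U \is unitarymx ->
  quad (udiag U d) (eigvec U i) = d i.
Proof.
move=> /unitarymxP UU; rewrite quad_eigvec /udiag !mulmxA UU mul1mx -mulmxA UU mulmx1.
by rewrite !mxE eqxx mulr1n embK.
Qed.

Lemma quad1_eigvec m (U : 'M[C]_m) i : U \is unitarymx ->
  quad 1%:M (eigvec U i) = 1.
Proof. by move=> /unitarymxP UU; rewrite quad_eigvec mulmx1 UU mxE eqxx -(rmorph1 emb) embK. Qed.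

Lemma sum_quad_sq_le m (U : 'M[C]_m) M : U \is unitarymx ->
  \sum_i quad M (eigvec U i) ^+ 2 <= retr (M ^t* *m M).
Proof.
move=> Uu; have -> : retr (M ^t* *m M) =
    retr ((U *m M *m U ^t*) ^t* *m (U *m M *m U ^t*)).
  rewrite !ctM trmxCK !mulmxA (mulmxKtV _ Uu erefl) -!mulmxA [RHS]retrC !mulmxA.
  by rewrite (mulmxKtV _ Uu erefl).
under eq_bigr do rewrite quad_eigvec.
move: (U *m M *m U ^t*) => N; rewrite /retr /mxtrace re_sum.
apply: ler_sum => i _; rewrite mxE re_sum (bigD1 i) //= !mxE.
apply: le_trans (sqr_re_le _) _; rewrite lerDl.
by apply: sumr_ge0 => k _; rewrite !mxE; exact: reMJ.
Qed.

End Quad.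

(** * Matrix units at a site and the conditional traces *)

Section Sites.
Variables (R : realType) (C : cplx R) (n : nat).
Local Notation M := 'M[C]_(qdim n).
Implicit Types (X Y Z : M) (x y z : word n) (i j : 'I_n) (a b : 'I_2).

Definition ent X x y : C := X (enum_rank x) (enum_rank y).

Lemma ent_inj X Y : (forall x y, ent X x y = ent Y x y) -> X = Y.
Proof.
move=> h; apply/matrixP => p q.
by have := h (enum_val p) (enum_val q); rewrite /ent !enum_valK.
Qed.

Lemma entM X Y x y : ent (X *m Y) x y = \sum_z ent X x z * ent Y z y.
Proof.
rewrite /ent mxE (reindex (@enum_rank _)) //=.
by apply: onW_bij; exact: enum_rank_bij.
Qed.

Lemma ent1 x y : ent 1%:M x y = (x == y)%:R.
Proof. by rewrite /ent mxE (inj_eq enum_rank_inj). Qed.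

Lemma ent_ct X x y : ent (X ^t*) x y = Num.conj (ent X y x).
Proof. by rewrite /ent !mxE. Qed.

(** The matrix unit e_ab acting on the tensor factor j and trivially elsewhere. *)
Definition site j a b : M :=
  \matrix_(p, q) (((enum_val p : word n) j == a) && ((enum_val q : word n) == setbit j (enum_val p) b))%:R.

Lemma ent_site j a b x y : ent (site j a b) x y = ((x j == a) && (y == setbit j x b))%:R.
Proof. by rewrite /ent mxE !enum_rankK. Qed.

Lemma setbit_at j x b : setbit j x b j = b.
Proof. by rewrite ffunE eqxx. Qed.

Lemma setbit_off i j x b : i != j -> setbit j x b i = x i.
Proof. by move=> /negPf ij; rewrite ffunE ij. Qed.

Lemma setbit_setbit j x a b : setbit j (setbit j x a) b = setbit j x b.
Proof. by apply/ffunP => k; rewrite !ffunE; case: eqP. Qed.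

Lemma setbit_id j x : setbit j x (x j) = x.
Proof. by apply/ffunP => k; rewrite !ffunE; case: eqP => // ->. Qed.

Lemma setbitC i j x a b : i != j ->
  setbit i (setbit j x b) a = setbit j (setbit i x a) b.
Proof.
move=> ij; apply/ffunP => k; rewrite !ffunE; case: eqP => // ->.
by rewrite (negPf ij).
Qed.

Lemma setbit_eq j x y a b :
  (y j == a) && (x == setbit j y b) = (x j == b) && (y == setbit j x a).
Proof.
apply/andP/andP => -[/eqP <- /eqP ->].
  by rewrite setbit_at setbit_setbit setbit_id !eqxx.
by rewrite setbit_at setbit_setbit setbit_id !eqxx.
Qed.

Lemma ent_sitel j a b X x y :
  ent (site j a b *m X) x y = (x j == a)%:R * ent X (setbit j x b) y.
Proof.
rewrite entM (bigD1 (setbit j x b)) //= big1 => [|z /negPf zx].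
  by rewrite ent_site eqxx andbT addr0.
by rewrite ent_site zx andbF mul0r.
Qed.

Lemma ent_siter j a b X x y :
  ent (X *m site j a b) x y = (y j == b)%:R * ent X x (setbit j y a).
Proof.
rewrite entM (bigD1 (setbit j y a)) //= big1 => [|z /negPf zx].
  by rewrite ent_site setbit_eq eqxx andbT addr0 mulrC.
by rewrite ent_site setbit_eq zx andbF mulr0.
Qed.

Lemma siteM j a b c d : site j a b *m site j c d = (b == c)%:R *: site j a d.
Proof.
apply: ent_inj => x y; rewrite ent_sitel ent_site setbit_at setbit_setbit.
have -> : ent ((b == c)%:R *: site j a d) x y = (b == c)%:R * ent (site j a d) x y.
  by rewrite /ent mxE.
rewrite ent_site.
by case: (x j == a); case: (b == c); rewrite /= ?(mulr0n, mulr1n) ?(mul0r, mul1r, mulr0).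
Qed.

Lemma site_ct j a b : (site j a b) ^t* = site j b a.
Proof.
by apply: ent_inj => x y; rewrite ent_ct !ent_site rmorph_nat setbit_eq.
Qed.

Lemma sum_site j : \sum_a site j a a = 1%:M.
Proof.
apply: ent_inj => x y; rewrite ent1.
have -> : ent (\sum_a site j a a) x y = \sum_a ent (site j a a) x y.
  by rewrite /ent summxE.
rewrite (bigD1 (x j)) //= big1 => [|a ax]; last by rewrite ent_site eq_sym (negPf ax).
by rewrite addr0 ent_site eqxx setbit_id eq_sym.
Qed.

Lemma siteC i j a b c d : i != j ->
  site i a b *m site j c d = site j c d *m site i a b.
Proof.
move=> ij; apply: ent_inj => x y; rewrite !ent_sitel !ent_site.
have ji : j != i by rewrite eq_sym.
rewrite (setbit_off _ _ ji) (setbit_off _ _ ij) setbitC //.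
by case: (x i == a); case: (x j == c); rewrite /= ?(mulr0n, mulr1n) ?(mul0r, mul1r, mulr0).
Qed.

(** Z lies in the commutant of the matrix units at j, that is, Z acts as the identity on
the tensor factor j. *)
Definition off j Z := forall a b, site j a b *m Z = Z *m site j a b.

Lemma off_site i j a b : i != j -> off i (site j a b).
Proof. by move=> ij c d; exact: siteC. Qed.

Lemma off_ct j Z : off j Z -> off j (Z ^t*).
Proof.
by move=> h a b; have := congr1 (fun X : M => X ^t*) (h b a); rewrite !ctM site_ct.
Qed.

Lemma offM j Y Z : off j Y -> off j Z -> off j (Y *m Z).
Proof. by move=> hY hZ a b; rewrite mulmxA hY -mulmxA hZ mulmxA. Qed.

(** The average over the matrix units of the factor j is the normalised partial trace over
that factor: the conditional expectation onto the operators that act trivially there.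
This form shows positivity and the bimodule property at once. *)
Definition cexp j X : M :=
  locked_with cexp_key
    (2^-1%:K *: \sum_a \sum_b (site j a b) ^t* *m X *m site j a b).

Lemma cexpE j X :
  cexp j X = 2^-1%:K *: \sum_a \sum_b (site j a b) ^t* *m X *m site j a b.
Proof. by rewrite /cexp locked_withE. Qed.

Lemma cexpD j X Y : cexp j (X + Y) = cexp j X + cexp j Y.
Proof.
rewrite !cexpE -scalerDr -big_split; congr (_ *: _); apply: eq_bigr => a _.
rewrite -big_split; apply: eq_bigr => b _.
by rewrite mulmxDr mulmxDl.
Qed.

Lemma cexpZ j (c : C) X : cexp j (c *: X) = c *: cexp j X.
Proof.
rewrite !cexpE [RHS]scalerA mulrC -scalerA; congr (_ *: _); rewrite scaler_sumr; apply: eq_bigr => a _.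
rewrite scaler_sumr; apply: eq_bigr => b _.
by rewrite -scalemxAr -scalemxAl.
Qed.

Lemma cexpB j X Y : cexp j (X - Y) = cexp j X - cexp j Y.
Proof. by rewrite cexpD -scaleN1r cexpZ scaleN1r. Qed.

Lemma cexp0 j : cexp j 0 = 0.
Proof. by rewrite -(scale0r 0) cexpZ !scale0r. Qed.

Lemma cexp_sum (I : finType) (P : pred I) j (F : I -> M) :
  cexp j (\sum_(k | P k) F k) = \sum_(k | P k) cexp j (F k).
Proof. by apply: (big_morph (cexp j)) => [X Y|]; [exact: cexpD | exact: cexp0]. Qed.

Lemma off_cexp j X : off j (cexp j X).
Proof.
move=> c d; rewrite !cexpE -scalemxAr -scalemxAl; congr (_ *: _).
rewrite mulmx_sumr mulmx_suml.
under eq_bigr => a _.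
  rewrite mulmx_sumr.
  under eq_bigr => b _ do rewrite !mulmxA site_ct siteM -!scalemxAl.
  rewrite (bigD1 d) //= big1 => [|b bd]; last by rewrite eq_sym (negPf bd) scale0r.
  rewrite eqxx scale1r addr0.
  over.
under [RHS]eq_bigr => a _.
  rewrite mulmx_suml.
  under eq_bigr => b _ do rewrite -!mulmxA siteM -!scalemxAr.
  rewrite (bigD1 c) //= big1 => [|b bd]; last by rewrite (negPf bd) scale0r.
  rewrite eqxx scale1r addr0 site_ct mulmxA.
  over.
by [].
Qed.

Lemma sum_site_ctl j : \sum_a \sum_b (site j a b) ^t* *m site j a b = 2%:K%:M.
Proof.
under eq_bigr => a _.
  under eq_bigr => b _ do rewrite site_ct siteM eqxx scale1r.
  rewrite sum_site; over.
by rewrite !big_ord_recl big_ord0 addr0 -mulr2n -scaler_nat rmorph_nat scalemx1.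
Qed.

Lemma scale_half X : 2^-1%:K *: (2%:K *: X) = X.
Proof. by rewrite scalerA -rmorphM mulVf ?pnatr_eq0 // rmorph1 scale1r. Qed.

(** Bimodule property of a conditional expectation: its range consists of the operators
that commute with the matrix units at j, and these pass through the average. *)
Lemma cexp_modr j X Z : off j Z -> cexp j (X *m Z) = cexp j X *m Z.
Proof.
move=> h; rewrite !cexpE -scalemxAl; congr (_ *: _); rewrite mulmx_suml.
apply: eq_bigr => a _; rewrite mulmx_suml; apply: eq_bigr => b _.
by rewrite -!mulmxA h.
Qed.

Lemma cexp_modl j X Z : off j Z -> cexp j (Z *m X) = Z *m cexp j X.
Proof.
move=> h; rewrite !cexpE -scalemxAr; congr (_ *: _); rewrite mulmx_sumr.
apply: eq_bigr => a _; rewrite mulmx_sumr; apply: eq_bigr => b _.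
by rewrite site_ct !mulmxA h.
Qed.

Lemma cexp1 j : cexp j 1%:M = 1%:M.
Proof.
rewrite !cexpE; under eq_bigr => a _ do under eq_bigr => b _ do rewrite mulmx1.
by rewrite sum_site_ctl -[_%:M]scalemx1 scale_half.
Qed.

Lemma cexp_fix j Z : off j Z -> cexp j Z = Z.
Proof. by move=> h; rewrite -[Z in LHS]mul1mx cexp_modr // cexp1 mul1mx. Qed.

Lemma cexp_idem j X : cexp j (cexp j X) = cexp j X.
Proof. by apply: cexp_fix; exact: off_cexp. Qed.

Lemma cexpC i j X : cexp i (cexp j X) = cexp j (cexp i X).
Proof.
have [->//|ij] := eqVneq i j.
rewrite [cexp j X]cexpE [in RHS]cexpE cexpZ; congr (_ *: _).
rewrite cexp_sum; apply: eq_bigr => a _; rewrite cexp_sum; apply: eq_bigr => b _.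
rewrite cexp_modr; last exact: off_site.
by rewrite cexp_modl //; apply: off_ct; exact: off_site.
Qed.

Lemma cexp_ct j X : cexp j (X ^t*) = (cexp j X) ^t*.
Proof.
rewrite !cexpE ctZ ct_sum; congr (_ *: _); apply: eq_bigr => a _.
rewrite ct_sum; apply: eq_bigr => b _.
by rewrite !ctM trmxCK mulmxA.
Qed.

Lemma cexp_sa j X Y : retr ((cexp j X) ^t* *m Y) = retr (X ^t* *m cexp j Y).
Proof.
rewrite -cexp_ct !cexpE -scalemxAl -scalemxAr !retrZ; congr (_ * _).
transitivity (\sum_a \sum_b
    retr ((site j a b) ^t* *m X ^t* *m site j a b *m Y)).
  rewrite mulmx_suml retr_sum; apply: eq_bigr => a _.
  by rewrite mulmx_suml retr_sum.
rewrite exchange_big mulmx_sumr retr_sum; apply: eq_bigr => a _.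
rewrite mulmx_sumr retr_sum; apply: eq_bigr => b _.
by rewrite !site_ct -!mulmxA retrC -!mulmxA.
Qed.

Lemma cexp_psd j X : psd X -> psd (cexp j X).
Proof.
move=> h; rewrite cexpE; apply: psdZ; first by rewrite invr_ge0.
by apply: psd_sum => a _; apply: psd_sum => b _; exact: psd_conj.
Qed.

End Sites.

(** * Local depolarising channels and their products *)

Section Semigroup.
Variables (R : realType) (C : cplx R) (n : nat).
Local Notation M := 'M[C]_(qdim n).
Implicit Types (X Y Z : M) (i j : 'I_n) (r t : R) (s : seq 'I_n).

Definition cdif j X : M := locked_with cdif_key (X - cexp j X).

Lemma cdifE j X : cdif j X = X - cexp j X.
Proof. by rewrite /cdif locked_withE. Qed.

Lemma cdifD j X Y : cdif j (X + Y) = cdif j X + cdif j Y.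
Proof. by rewrite !cdifE cexpD opprD addrACA. Qed.

Lemma cdifZ j (c : C) X : cdif j (c *: X) = c *: cdif j X.
Proof. by rewrite !cdifE cexpZ scalerBr. Qed.

Lemma cdifB j X Y : cdif j (X - Y) = cdif j X - cdif j Y.
Proof. by rewrite cdifD -scaleN1r cdifZ scaleN1r. Qed.

Lemma cexp_cdif j X : cexp j (cdif j X) = 0.
Proof. by rewrite cdifE cexpB cexp_idem subrr. Qed.

Lemma cdif_idem j X : cdif j (cdif j X) = cdif j X.
Proof. by rewrite [LHS]cdifE cexp_cdif subr0. Qed.

Lemma cexp_cdifC i j X : cexp i (cdif j X) = cdif j (cexp i X).
Proof. by rewrite !cdifE cexpB [cexp i (cexp j _)]cexpC. Qed.

Lemma cdifC i j X : cdif i (cdif j X) = cdif j (cdif i X).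
Proof. by rewrite [LHS]cdifE cexp_cdifC -cdifB -cdifE. Qed.

Lemma cdif_sa j X Y : retr ((cdif j X) ^t* *m Y) = retr (X ^t* *m cdif j Y).
Proof. by rewrite !cdifE ctB mulmxBl mulmxBr !retrB cexp_sa. Qed.

Definition depol j r X : M :=
  locked_with depol_key (cexp j X + r%:K *: cdif j X).

Lemma depolE j r X : depol j r X = cexp j X + r%:K *: cdif j X.
Proof. by rewrite /depol locked_withE. Qed.

Lemma depol_mix j r X : depol j r X = (1 - r)%:K *: cexp j X + r%:K *: X.
Proof. by rewrite !depolE !cdifE; mxring. Qed.

Lemma depolD j r X Y : depol j r (X + Y) = depol j r X + depol j r Y.
Proof. by rewrite !depolE cexpD cdifD scalerDr addrACA. Qed.

Lemma depolZ j r (c : C) X : depol j r (c *: X) = c *: depol j r X.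
Proof. by rewrite !depolE cexpZ cdifZ; mxring. Qed.

Lemma depolB j r X Y : depol j r (X - Y) = depol j r X - depol j r Y.
Proof. by rewrite depolD -scaleN1r depolZ scaleN1r. Qed.

Lemma depol_sum j r s (F : 'I_n -> M) :
  depol j r (\sum_(k <- s) F k) = \sum_(k <- s) depol j r (F k).
Proof.
apply: (big_morph (depol j r)) => [X Y|]; first exact: depolD.
by rewrite -(scale0r 0) depolZ !scale0r.
Qed.

Lemma cexp_depol i j r X : cexp i (depol j r X) = depol j r (cexp i X).
Proof. by rewrite !depolE cexpD cexpZ cexpC cexp_cdifC. Qed.

Lemma cdif_depol i j r X : cdif i (depol j r X) = depol j r (cdif i X).
Proof. by rewrite !cdifE depolB cexp_depol. Qed.

Lemma depolC i j r t X : depol i r (depol j t X) = depol j t (depol i r X).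
Proof. by rewrite [LHS]depolE cexp_depol cdif_depol -depolZ -depolD -depolE. Qed.

Lemma depol_sa j r X Y : retr ((depol j r X) ^t* *m Y) = retr (X ^t* *m depol j r Y).
Proof.
rewrite !depolE ctD ctZ mulmxDl mulmxDr -scalemxAl -scalemxAr !retrD !retrZ.
by rewrite cexp_sa cdif_sa.
Qed.

Lemma depolM j r t X : depol j r (depol j t X) = depol j (r * t) X.
Proof.
rewrite [LHS]depolE cexp_depol cdif_depol !depolE cexp_idem cexp_cdif cdif_idem.
rewrite !cdifE cexp_idem subrr scaler0 addr0 add0r.
by rewrite scalerA rmorphM.
Qed.

Lemma depol1r j X : depol j 1 X = X.
Proof. by rewrite !depolE rmorph1 scale1r !cdifE addrC subrK. Qed.

Lemma depol1 j r : depol j r 1%:M = 1%:M.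
Proof. by rewrite !depolE !cdifE cexp1 subrr scaler0 addr0. Qed.

Lemma depol_psd j r X : 0 <= r <= 1 -> psd X -> psd (depol j r X).
Proof.
move=> /andP[r0 r1] h; rewrite depol_mix; apply: psdD; last exact: psdZ.
by apply: psdZ; [rewrite subr_ge0|exact: cexp_psd].
Qed.

(** Pythagoras for the conditional expectation: the cross terms vanish by the bimodule
property and tau_j d_j = 0. *)
Lemma cexp_pyth j X :
  cexp j (X ^t* *m X) =
  (cexp j X) ^t* *m cexp j X + cexp j ((cdif j X) ^t* *m cdif j X).
Proof.
have o := off_cexp j X; have o' := off_ct o.
rewrite {1 2}(_ : X = cexp j X + cdif j X); last by rewrite !cdifE addrC subrK.
rewrite ctD mulmxDl !mulmxDr !cexpD (cexp_modl _ o') (cexp_modl _ o').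
rewrite (cexp_modr _ o) cexp_cdif cexp_idem mulmx0 addr0.
by rewrite cexp_ct cexp_cdif trmx0 map_mx0 mul0mx add0r.
Qed.

(** With X = t + D, t = tau_j X, the quantity r P(X* X) - r |P X|^2 - (1 - r) |d_j P X|^2 is exactly
r (1 - r) tau_j (D* D), since d_j P X = r D.  This one-site identity is the source of
the gradient estimate. *)
Lemma depol_schwarz j r X : 0 <= r <= 1 ->
  psd (r%:K *: depol j r (X ^t* *m X)
       - r%:K *: ((depol j r X) ^t* *m depol j r X)
       - (1 - r)%:K *: ((cdif j (depol j r X)) ^t* *m cdif j (depol j r X))).
Proof.
move=> /andP[r0 r1]; set H := (X in psd X).
suff -> : H = (r * (1 - r))%:K *: cexp j ((cdif j X) ^t* *m cdif j X).
  apply: psdZ; first by rewrite mulr_ge0 // subr_ge0.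
  by apply: cexp_psd; exact: psd_sq.
have e : cdif j (depol j r X) = r%:K *: cdif j X.
  by rewrite cdif_depol depolE cexp_cdif cdif_idem add0r.
rewrite /H depol_mix cexp_pyth e depolE.
have -> : X ^t* *m X = (cexp j X + cdif j X) ^t* *m (cexp j X + cdif j X).
  by rewrite cdifE addrC subrK.
rewrite !ctD !ctZ !mulmxDl !mulmxDr -!scalemxAl -!scalemxAr.
mxring.
Qed.

(** Kadison-Schwarz: the difference is r (1 - r) D* D + (1 - r) tau_j (D* D) with D = d_j X. *)
Lemma depol_ks j r X : 0 <= r <= 1 ->
  psd (depol j r (X ^t* *m X) - (depol j r X) ^t* *m depol j r X).
Proof.
move=> /andP[r0 r1]; set H := (X in psd X).
suff -> : H = (r * (1 - r))%:K *: ((cdif j X) ^t* *m cdif j X) +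
              (1 - r)%:K *: cexp j ((cdif j X) ^t* *m cdif j X).
  apply: psdD.
    by apply: psdZ; [rewrite mulr_ge0 // subr_ge0|exact: psd_sq].
  by apply: psdZ; [rewrite subr_ge0|apply: cexp_psd; exact: psd_sq].
rewrite /H depol_mix cexp_pyth depolE.
have -> : X ^t* *m X = (cexp j X + cdif j X) ^t* *m (cexp j X + cdif j X).
  by rewrite cdifE addrC subrK.
rewrite !ctD !ctZ !mulmxDl !mulmxDr -!scalemxAl -!scalemxAr.
mxring.
Qed.

Definition smooth r s X : M := foldr (fun j => depol j r) X s.

Lemma smoothD r s X Y : smooth r s (X + Y) = smooth r s X + smooth r s Y.
Proof. by elim: s => //= j s ->; exact: depolD. Qed.

Lemma smoothZ r s (c : C) X : smooth r s (c *: X) = c *: smooth r s X.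
Proof. by elim: s => //= j s ->; exact: depolZ. Qed.

Lemma smoothB r s X Y : smooth r s (X - Y) = smooth r s X - smooth r s Y.
Proof. by rewrite smoothD -scaleN1r smoothZ scaleN1r. Qed.

Lemma depol_smooth j r t s X : depol j r (smooth t s X) = smooth t s (depol j r X).
Proof. by elim: s => [|i s IH]; [by []|rewrite /= -IH; exact: depolC]. Qed.

Lemma cexp_smooth j t s X : cexp j (smooth t s X) = smooth t s (cexp j X).
Proof. by elim: s => [|i s IH]; [by []|rewrite /= -IH; exact: cexp_depol]. Qed.

Lemma cdif_smooth j t s X : cdif j (smooth t s X) = smooth t s (cdif j X).
Proof. by elim: s => [|i s IH]; [by []|rewrite /= -IH; exact: cdif_depol]. Qed.

Lemma smooth_sa r s X Y :
  retr ((smooth r s X) ^t* *m Y) = retr (X ^t* *m smooth r s Y).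
Proof.
elim: s X Y => //= i s IH X Y.
by rewrite depol_smooth IH depol_sa depol_smooth.
Qed.

Lemma smoothM r t s X : smooth r s (smooth t s X) = smooth (r * t) s X.
Proof. by elim: s => [|i s IH]; [by []|rewrite /= -IH -depol_smooth depolM]. Qed.

Lemma smooth1r s X : smooth 1 s X = X.
Proof. by elim: s => //= i s ->; exact: depol1r. Qed.

Lemma smooth1 r s : smooth r s 1%:M = 1%:M.
Proof. by elim: s => //= i s ->; exact: depol1. Qed.

Lemma smooth_psd r s X : 0 <= r <= 1 -> psd X -> psd (smooth r s X).
Proof. by move=> h hX; elim: s => //= i s; exact: depol_psd. Qed.

Lemma smooth_ks r s X : 0 <= r <= 1 ->
  psd (smooth r s (X ^t* *m X) - (smooth r s X) ^t* *m smooth r s X).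
Proof.
move=> h; elim: s => [|i s IH] /=; first by rewrite subrr; exact: psd0.
have := psdD (depol_psd i h IH) (depol_ks i (smooth r s X) h).
by rewrite depolB addrA subrK.
Qed.

(** The one-site estimate propagates: pushing the estimate for the sites s through the
channel at a new site i keeps it positive, [depol_schwarz] creates the gradient term
at i, and Kadison-Schwarz moves the channel inside the terms |d_j .|^2 already
present. *)
Lemma smooth_gradient r s X : 0 <= r <= 1 ->
  psd (r%:K *: smooth r s (X ^t* *m X)
       - r%:K *: ((smooth r s X) ^t* *m smooth r s X)
       - (1 - r)%:K *: \sum_(j <- s)
           (cdif j (smooth r s X)) ^t* *m cdif j (smooth r s X)).
Proof.
move=> h; elim: s => [|i s IH] /=.
  by rewrite big_nil scaler0 subr0 subrr; exact: psd0.
have /andP[r0 r1] := h; have r1' : 0 <= 1 - r by rewrite subr_ge0.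
set B := smooth r s X in IH *; set A := smooth r s (X ^t* *m X) in IH *.
have h1 := depol_psd i h IH; have h2 := depol_schwarz i B h.
have h3 : psd ((1 - r)%:K *: \sum_(j <- s) (depol i r ((cdif j B) ^t* *m cdif j B)
    - (cdif j (depol i r B)) ^t* *m cdif j (depol i r B))).
  apply: psdZ => //; elim: s {IH A B h1 h2} (B) => [|j s IH] B.
    by rewrite big_nil; exact: psd0.
  by rewrite big_cons; apply: psdD => //; rewrite cdif_depol; exact: depol_ks.
have := psdD (psdD h1 h2) h3; congr psd.
rewrite !depolB !depolZ depol_sum big_cons sumrB.
mxring.
Qed.

(** The polynomial r |-> tr (X* P_r Y), built by splitting along tau_j + r d_j one site at a
time.  For X = Y the recursion adds nonnegative constants only, so the coefficients,
which are the masses of X at each level, are nonnegative by construction. *)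
Fixpoint corr s X Y : {poly R} :=
  if s is j :: s' then corr s' (cexp j X) (cexp j Y) + 'X * corr s' (cdif j X) (cdif j Y)
  else (retr (X ^t* *m Y))%:P.

Lemma corrE s X Y r : (corr s X Y).[r] = retr (X ^t* *m smooth r s Y).
Proof.
elim: s X Y => [|j s IH] X Y /=; first by rewrite hornerC.
rewrite hornerD hornerM hornerX !IH -cexp_smooth -cdif_smooth cexp_sa cdif_sa.
by rewrite cexp_idem cdif_idem !depolE mulmxDr retrD -scalemxAr retrZ.
Qed.

Lemma corr_ge0 s X k : 0 <= (corr s X X)`_k.
Proof.
elim: s X k => [|j s IH] X k /=.
  by rewrite coefC; case: eqP => // _; exact: retr_ge0.
rewrite coefD coefXM addr_ge0 //.
by case: eqP.
Qed.

Lemma corr0l s Y : corr s 0 Y = 0.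
Proof.
elim: s Y => [|j s IH] Y /=.
  by rewrite trmx0 map_mx0 mul0mx /retr mxtrace0 re0.
by rewrite !cdifE cexp0 subr0 !IH mulr0 addr0.
Qed.

(** The Euler operator r d/dr multiplies level k by k, and a component of level k is fixed by
d_j for k of the sites j and annihilated by d_j for the others. *)
Lemma corr_deriv s X Y :
  'X * (corr s X Y)^`() = \sum_(j <- s) corr s (cdif j X) (cdif j Y).
Proof.
elim: s X Y => [|j s IH] X Y /=; first by rewrite big_nil derivC mulr0.
rewrite derivD derivM derivX mul1r mulrDr (mulrDr 'X (corr _ _ _)) IH [in 'X * ('X * _)]IH.
rewrite big_cons (cexp_cdif j X) (cexp_cdif j Y) corr0l add0r (cdif_idem j X) (cdif_idem j Y).
under [in RHS]eq_bigr => i _ do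
  rewrite !cexp_cdifC !(cdifC j i).
by rewrite big_split /= -mulr_sumr addrCA.
Qed.

End Semigroup.

(** * Singular values of columns of matrices *)

Section Singular.
Variables (R : realType) (C : cplx R) (m : nat).
Local Notation M := 'M[C]_m.
Implicit Types (I : finType).

Lemma real_cauchy_schwarz_sq (I : finType) (a b : I -> R) :
  (\sum_i a i * b i) ^+ 2 <= (\sum_i a i ^+ 2) * (\sum_i b i ^+ 2).
Proof.
apply: discr_le => [|x]; first by apply: sumr_ge0 => i _; exact: sqr_ge0.
have -> : \sum_i a i ^+ 2 - 2 * x * (\sum_i a i * b i) + x ^+ 2 * (\sum_i b i ^+ 2) =
    \sum_i (a i - x * b i) ^+ 2.
  rewrite !mulr_sumr -sumrN -!big_split /=; apply: eq_bigr => i _; ring.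
by apply: sumr_ge0 => i _; exact: sqr_ge0.
Qed.

Lemma real_cauchy_schwarz (I : finType) (a b : I -> R) :
  \sum_i a i * b i <= Num.sqrt (\sum_i a i ^+ 2) * Num.sqrt (\sum_i b i ^+ 2).
Proof.
rewrite -sqrtrM; last by apply: sumr_ge0 => i _; exact: sqr_ge0.
apply: le_trans (ler_norm _) _.
by rewrite -sqrtr_sqr ler_wsqrtr ?real_cauchy_schwarz_sq.
Qed.

(** The squared modulus of the family X regarded as a column of matrices. *)
Definition gram I (X : I -> M) : M := \sum_j (X j) ^t* *m X j.

Lemma gram_ct I (X : I -> M) : (gram X) ^t* = gram X.
Proof.
by rewrite /gram ct_sum; apply: eq_bigr => j _; rewrite ctM trmxCK.
Qed.

Lemma gram_psd I (X : I -> M) : psd (gram X).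
Proof. by apply: psd_sum => j _; exact: psd_sq. Qed.

Definition single (X : M) (_ : 'I_1) : M := X.

Lemma gram1 (X : M) : gram (single X) = X ^t* *m X.
Proof. by rewrite /gram big_ord1. Qed.

Definition sbase I (X : I -> M) (i : 'I_m) : 'cV[C]_m :=
  eigvec (spectralmx (gram X)) i.

(** Square roots of the eigenvalues of gram X: the singular values of the column X. *)
Definition singv I (X : I -> M) (i : 'I_m) : R :=
  Num.sqrt (quad (gram X) (sbase X i)).

Lemma singv_ge0 I (X : I -> M) i : 0 <= singv X i.
Proof. exact: sqrtr_ge0. Qed.

Lemma singv_sq I (X : I -> M) i : singv X i ^+ 2 = quad (gram X) (sbase X i).
Proof. by rewrite sqr_sqrtr //; exact: gram_psd. Qed.

Lemma sum_singv_sq I (X : I -> M) : \sum_i singv X i ^+ 2 = retr (gram X).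
Proof.
under eq_bigr => i _ do rewrite singv_sq.
by rewrite sum_quad_eigvec // spectral_unitarymx.
Qed.

Lemma gram_udiag I (X : I -> M) :
  gram X = udiag (spectralmx (gram X)) (fun i => singv X i ^+ 2).
Proof.
rewrite {1}(spectral_udiag (gram_ct X)); apply: udiagE => i.
rewrite singv_sq /sbase.
have := quad_udiag (fun i => re (spectral_diag (gram X) 0 i)) i
  (spectral_unitarymx (gram X)).
by rewrite -spectral_udiag ?gram_ct.
Qed.

Definition tnorm I (X : I -> M) : R := \sum_i singv X i.

Lemma tnorm_ge0 I (X : I -> M) : 0 <= tnorm X.
Proof. by apply: sumr_ge0 => i _; exact: singv_ge0. Qed.

(** Evaluate the pairing in an eigenbasis of gram X and apply Cauchy-Schwarz to each basis
vector.  Hoelder-type bounds for the pairing thereby become inequalities between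
numbers. *)
Lemma col_pairing I (X Y : I -> M) :
  \sum_j retr ((X j) ^t* *m Y j) <=
  \sum_i singv X i * Num.sqrt (quad (gram Y) (sbase X i)).
Proof.
rewrite -retr_sum -(sum_quad_eigvec _ (spectral_unitarymx (gram X))).
apply: ler_sum => i _; rewrite quad_sum -/(sbase X i) /singv /gram !quad_sum.
under eq_bigr => j _ do rewrite quadM.
under [in leRHS]eq_bigr => j _ do rewrite quadM.
under [in X in _ * X]eq_bigr => j _ do rewrite quadM.
exact: cauchy_schwarz.
Qed.

Lemma quad_bound I (X Y : I -> M) (K : R) i :
  psd (K%:K *: 1%:M - gram Y) -> quad (gram Y) (sbase X i) <= K.
Proof.
move=> /(_ (sbase X i)); rewrite quadB quadZ quad1_eigvec ?spectral_unitarymx //.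
by rewrite mulr1 subr_ge0.
Qed.

Lemma col_pairing_inf I (X Y : I -> M) (K : R) :
  psd (K%:K *: 1%:M - gram Y) ->
  \sum_j retr ((X j) ^t* *m Y j) <= Num.sqrt K * tnorm X.
Proof.
move=> h; apply: le_trans (col_pairing X Y) _.
rewrite /tnorm mulr_sumr; apply: ler_sum => i _; rewrite mulrC.
by apply: ler_wpM2r; [exact: singv_ge0|apply: ler_wsqrtr; exact: quad_bound].
Qed.

(** If g <= sqrt K, use g y <= y^2 / 2 + g^2 / 2 and g^2 <= K^(1 - p/2) g^p, as p <= 2.  If g > sqrt K,
use y <= sqrt K and g sqrt K <= K^(1 - p/2) g^p, as p >= 1. *)
Lemma young_pow (p K g y : R) : 1 <= p <= 2 -> 0 < K -> 0 <= g -> 0 <= y ->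
  y ^+ 2 <= K -> g * y <= 2^-1 * y ^+ 2 + K `^ (1 - p / 2) * g `^ p.
Proof.
move=> /andP[p1 p2] K0 g0 y0 yK.
have [->|gN] := eqVneq g 0.
  rewrite mul0r addr_ge0 ?mulr_ge0 ?invr_ge0 ?sqr_ge0 ?powR_ge0 //.
have gp : 0 < g by rewrite lt_def gN.
set s := Num.sqrt K.
have s0 : 0 < s by rewrite sqrtr_gt0.
have sK : s ^+ 2 = K by rewrite sqr_sqrtr // ltW.
have ys : y <= s by rewrite -[y]ger0_norm // -sqrtr_sqr ler_wsqrtr.
have KE : K `^ (1 - p / 2) = s `^ (2 - p).
  by rewrite -sK -powR_mulrn ?(ltW s0) // -powRrM; congr (_ `^ _); field.
rewrite KE; have [gs|sg] := leP g s.
  have : g ^+ 2 <= s `^ (2 - p) * g `^ p.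
    have -> : g ^+ 2 = g `^ (2 - p) * g `^ p.
      rewrite -powRD; last by rewrite gN implybT.
      by rewrite subrK powR_mulrn.
    apply: ler_wpM2r; first exact: powR_ge0.
    by apply: ge0_ler_powR; rewrite ?nnegrE ?subr_ge0 // ltW.
  have : 0 <= s `^ (2 - p) * g `^ p by rewrite mulr_ge0 ?powR_ge0.
  have := sqr_ge0 (g - y); rewrite sqrrB; lra.
have : g * s <= s `^ (2 - p) * g `^ p.
  have -> : s `^ (2 - p) = s * s `^ (1 - p).
    rewrite -{2}[s]powRr1 ?(ltW s0) // -powRD; last by rewrite (gt_eqF s0) implybT.
    by congr (_ `^ _); ring.
  have -> : g * s = s * g `^ (1 - p) * g `^ p.
    rewrite -mulrA -powRD; last by rewrite gN implybT.
    by rewrite subrK powRr1 // mulrC.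
  rewrite ler_wpM2r ?powR_ge0 // ler_wpM2l ?(ltW s0) //.
  have H (x : R) : 0 < x -> x `^ (1 - p) = (x `^ (p - 1))^-1.
    by move=> x0; rewrite -powRN opprB.
  rewrite !H // lef_pV2 ?posrE ?powR_gt0 //.
  by apply: ge0_ler_powR; rewrite ?nnegrE ?subr_ge0 // ltW.
have : g * y <= g * s by rewrite ler_wpM2l.
have := sqr_ge0 y; lra.
Qed.

(** The replacement for Hoelder's inequality with exponents p and p': the quadratic term
will be absorbed, and the power of K has the right exponent for all p at once. *)
Lemma col_pairing_pow I (X Y : I -> M) (p K : R) : 1 <= p <= 2 -> 0 < K ->
  psd (K%:K *: 1%:M - gram Y) ->
  \sum_j retr ((X j) ^t* *m Y j) <=
  2^-1 * retr (gram Y) + K `^ (1 - p / 2) * \sum_i (singv X i) `^ p.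
Proof.
move=> hp K0 h; apply: le_trans (col_pairing X Y) _.
rewrite -(sum_quad_eigvec _ (spectral_unitarymx (gram X))) !mulr_sumr -big_split /=.
apply: ler_sum => i _; rewrite -/(sbase X i).
have q0 := gram_psd Y (sbase X i).
rewrite -{2}(sqr_sqrtr q0).
apply: young_pow; rewrite ?singv_ge0 ?sqrtr_ge0 // sqr_sqrtr //.
exact: quad_bound.
Qed.

Lemma psd_udiag (U : M) d : (forall i, 0 <= d i) -> psd (udiag U d).
Proof.
move=> d0; have -> : udiag U d = (diag_mx (\row_i (Num.sqrt (d i))%:K) *m U) ^t*
    *m (diag_mx (\row_i (Num.sqrt (d i))%:K) *m U).
  rewrite /udiag ctM -!mulmxA; congr (_ *m _); rewrite mulmxA; congr (_ *m _).
  apply/matrixP => i j; rewrite mul_mx_diag !mxE.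
  case: (eqVneq i j) => [->|ij]; rewrite ?eqxx ?mulr1n.
    by rewrite embJ -rmorphM -expr2 sqr_sqrtr.
  by rewrite /= !mulr0n rmorph0 mul0r.
exact: psd_sq.
Qed.

Lemma udiag1 (U : M) : U \is unitarymx -> udiag U (fun=> 1) = 1%:M.
Proof.
move=> Uu; rewrite /udiag (_ : \row__ _ = const_mx 1) ?diag_const_mx.
  by rewrite mulmx1 unitary_ctK.
by apply/rowP => i; rewrite !mxE rmorph1.
Qed.

Lemma udiagB (U : M) d e : udiag U d - udiag U e = udiag U (fun i => d i - e i).
Proof.
rewrite /udiag -mulmxBl -mulmxBr -raddfB; congr (_ *m diag_mx _ *m _).
by apply/rowP => i; rewrite !mxE rmorphB.
Qed.

(** V is the partial isometry of the polar decomposition of X; inverting the nonzero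
singular values only makes it a contraction. *)
Lemma tnorm_attained (X : M) :
  exists V : M, psd (1%:M - V ^t* *m V) /\
    retr (X ^t* *m V) = tnorm (single X).
Proof.
set g := singv (single X); set U := spectralmx (gram (single X)).
have Uu : U \is unitarymx by exact: spectral_unitarymx.
have HX : X ^t* *m X = udiag U (fun i => g i ^+ 2) by rewrite -gram1 gram_udiag.
exists (X *m udiag U (fun i => (g i)^-1)); split.
  rewrite ctM ct_udiag mulmxA -(mulmxA _ (X ^t*)) HX !udiagM // -(udiag1 Uu) udiagB.
  apply: psd_udiag => i /=; have [->|gN] := eqVneq (g i) 0.
    by rewrite invr0 !mulr0 subr0.
  by rewrite (_ : _ * _ = 1) ?subrr //; field.
rewrite mulmxA HX udiagM // retr_udiag //; apply: eq_bigr => i _.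
have [E|gN] := eqVneq (g i) 0; first by rewrite E invr0 mulr0.
by rewrite expr2 mulfK.
Qed.

(** With singular values g_i of X and z_i^2 the diagonal of Z* Z in the eigenbasis, the pairing is at
most sum_i g_i z_i; Cauchy-Schwarz twice separates sum g_i, sum g_i^2 and sum z_i^4. *)
Lemma pairing_fourth (X Z : M) :
  retr (X ^t* *m Z) ^+ 2 <= tnorm (single X) *
    (Num.sqrt (retr (X ^t* *m X)) *
     Num.sqrt (retr ((Z ^t* *m Z) ^t* *m (Z ^t* *m Z)))).
Proof.
set g := singv (single X); set u := sbase (single X).
set q := fun i => quad (Z ^t* *m Z) (u i).
have q0 i : 0 <= q i by exact: psd_sq.
have g0 i : 0 <= g i by exact: singv_ge0.
have H : `|retr (X ^t* *m Z)| <= \sum_i g i * Num.sqrt (q i).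
  have P W : W ^t* *m W = Z ^t* *m Z ->
      retr (X ^t* *m W) <= \sum_i g i * Num.sqrt (q i).
    move=> e; have := col_pairing (single X) (fun=> W).
    by rewrite big_ord1 gram1 e.
  rewrite ler_norml lerNl P // andbT.
  have := P (- Z); rewrite [X ^t* *m _]mulmxN retrN; apply.
  by rewrite ctN mulmxN mulNmx opprK.
apply: (@le_trans _ _ ((\sum_i g i * Num.sqrt (q i)) ^+ 2)).
  by rewrite -[leLHS]real_normK ?num_real // lerXn2r ?nnegrE // (le_trans _ H).
have e : \sum_i g i * Num.sqrt (q i) = \sum_i Num.sqrt (g i) * Num.sqrt (g i * q i).
  by apply: eq_bigr => i _; rewrite sqrtrM // mulrA -expr2 sqr_sqrtr.
rewrite e; apply: le_trans (real_cauchy_schwarz_sq _ _) _.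
under eq_bigr => i _ do rewrite sqr_sqrtr //.
rewrite -/(tnorm _); apply: ler_wpM2l; first exact: tnorm_ge0.
under eq_bigr => i _ do rewrite sqr_sqrtr ?mulr_ge0 //.
apply: le_trans (real_cauchy_schwarz _ _) _; rewrite sum_singv_sq gram1.
apply: ler_wpM2l; first exact: sqrtr_ge0.
by apply: ler_wsqrtr; apply: sum_quad_sq_le; exact: spectral_unitarymx.
Qed.

End Singular.

(** * Derivative bounds with endpoint singularities *)

Section Analysis.
Import numFieldNormedType.Exports.
Variable R : realType.
Implicit Types (q : {poly R}) (r a b : R).

Lemma increment_le (f g df dg : R -> R) (a b : R) : a <= b ->
  (forall x, x \in `]a, b[%R -> is_derive x 1 f (df x)) ->
  (forall x, x \in `]a, b[%R -> is_derive x 1 g (dg x)) ->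
  {within `[a, b], continuous f} -> {within `[a, b], continuous g} ->
  (forall x, x \in `]a, b[%R -> df x <= dg x) ->
  f b - f a <= g b - g a.
Proof.
move=> ab hf hg cf cg hd.
move: ab; rewrite le_eqVlt => /predU1P[<-|ab]; first by rewrite !subrr.
have hh x : x \in `]a, b[%R -> is_derive x 1 (f - g) (df x - dg x).
  by move=> xab; apply: is_deriveB; [exact: hf|exact: hg].
have ch : {within `[a, b], continuous (f - g)}.
  by move=> x; apply: cvgB; [exact: cf|exact: cg].
have [c cab] := MVT ab hh ch.
rewrite -[(f - g) b]/(f b - g b) -[(f - g) a]/(f a - g a) => e.
have := hd c cab; have : (df c - dg c) * (b - a) = f b - f a - (g b - g a).
  by rewrite -e; ring.
have : 0 < b - a by rewrite subr_gt0.
move=> ba E h; have : (df c - dg c) * (b - a) <= 0.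
  by apply: mulr_le0_ge0; [rewrite subr_le0|exact: ltW].
by rewrite E subr_le0.
Qed.

Lemma horner_le_lim q (T a : R) : a < 1 ->
  (forall b, a < b < 1 -> q.[b] <= T) -> q.[1] <= T.
Proof.
move=> a1 h; rewrite leNgt; apply/negP => Tq.
have /cvgrPdist_lt/(_ (q.[1] - T)) := @continuous_horner R q 1.
rewrite subr_gt0 => /(_ Tq) /nbhs_ballP[e /= e0 H].
pose b := 1 - Num.min e (1 - a) / 2.
have m0 : 0 < Num.min e (1 - a) by rewrite lt_min e0 subr_gt0.
have me : Num.min e (1 - a) <= e by rewrite ge_min lexx.
have ma : Num.min e (1 - a) <= 1 - a by rewrite ge_min lexx orbT.
have /h hb : a < b < 1 by rewrite /b; apply/andP; split; lra.
have /= : `|q.[1] - q.[b]| < q.[1] - T.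
  by apply: H; rewrite /ball /= /b opprB addrCA subrr addr0 ger0_norm; lra.
rewrite ltr_norml => /andP[_]; lra.
Qed.

(** The right-hand side of the hypothesis divided by x is at most
4 S (1 - x)^(p/2 - 1) on (1/2, 1), the derivative of -(8 S / p) (1 - x)^(p/2).  The
endpoint 1 is reached by continuity of the polynomial. *)
Lemma horner_increment_pow q (S p r : R) : 1 <= p <= 2 -> 0 <= S ->
  2^-1 <= r <= 1 ->
  (forall x, 2^-1 < x < 1 -> x * q^`().[x] <= 2 * (x / (1 - x)) `^ (1 - p / 2) * S) ->
  q.[1] - q.[r] <= 8 * (1 - r) `^ (p / 2) * S.
Proof.
move=> /andP[p1 p2] S0 /andP[r2 r1] H.
have [->|rN1] := eqVneq r 1.
  by rewrite subrr mulr_ge0 // mulr_ge0 // powR_ge0.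
have r1' : r < 1 by rewrite lt_neqAle rN1.
rewrite lerBlDr; apply: (@horner_le_lim _ _ r) => // b /andP[rb b1].
rewrite -lerBlDr.
pose g x : R := - (4 * S / (p / 2)) * (1 - x) `^ (p / 2).
pose dg x : R := 4 * S * (1 - x) `^ (p / 2 - 1).
have hg (x : R) : x < 1 -> is_derive x 1 g (dg x).
  move=> x1; rewrite /g /dg.
  have x0 : 0 < 1 - x by rewrite subr_gt0.
  have d1 : is_derive x 1 (fun x : R => 1 - x) (-1).
    by rewrite -[-1]add0r; apply: is_deriveB.
  have := is_derive1_powR (p / 2) x0.
  move=> d2; have := is_derive1_comp (f := (fun y => y `^ (p / 2))) (g := fun x => 1 - x).
  move=> /(_ _ _ _ d2 d1) d3.
  have := is_deriveZ (- (4 * S / (p / 2))) d3.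
  move=> D; apply: (is_derive_eq D); rewrite /GRing.scale /=.
  by field; lra.
have rb' : r <= b by exact: ltW.
have := @increment_le (horner q) g (fun x => q^`().[x]) dg r b rb'.
move=> K; apply: (@le_trans _ _ (g b - g r)).
  apply: K => [x|||x].
  - by rewrite in_itv => /andP[_ xb]; apply: hg; exact: lt_trans b1.
  - by apply: continuous_subspaceT; exact: continuous_horner.
  - apply: derivable_within_continuous => x; rewrite in_itv /= => /andP[_ xb].
    by have [] := hg x (le_lt_trans xb b1).
  rewrite in_itv /= => /andP[rx xb].
  have x1 : x < 1 by exact: lt_trans b1.
  have x2 : 2^-1 < x by exact: le_lt_trans rx.
  have x0 : 0 < x by lra.
  have y0 : 0 < 1 - x by rewrite subr_gt0.
  have /H : 2^-1 < x < 1 by rewrite x1 x2.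
  rewrite powRM ?(ltW x0) ?invr_ge0 ?(ltW y0) //.
  have -> : (1 - x)^-1 `^ (1 - p / 2) = (1 - x) `^ (p / 2 - 1).
    by rewrite -powR_inv1 ?(ltW y0) // -powRrM; congr (_ `^ _); ring.
  have : x `^ (1 - p / 2) <= 1.
    rewrite -[leRHS](powRr0 x); apply: ger_powR; first by rewrite x0 ltW.
    by rewrite subr_ge0; lra.
  rewrite /dg; have := powR_ge0 (1 - x) (p / 2 - 1).
  have := powR_ge0 x (1 - p / 2).
  set A := x `^ _; set B := (1 - x) `^ _; move=> A0 B0 A1 hx.
  have : q^`().[x] * x <= 4 * S * B * x.
    rewrite mulrC; apply: (le_trans hx).
    have : 0 <= S * B * (1 - A) by rewrite !mulr_ge0 // subr_ge0.
    have : 0 <= S * B * (x - 2^-1) by rewrite !mulr_ge0 // subr_ge0 ltW.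
    nra.
  by rewrite ler_pM2r.
rewrite /g; have := powR_ge0 (1 - b) (p / 2).
set B := (1 - b) `^ _; have := powR_ge0 (1 - r) (p / 2); set A := (1 - r) `^ _ => A0 B0.
have e : 4 * S / (p / 2) = 8 * S * p^-1 by field; lra.
have q1 : p^-1 <= 1 by rewrite invf_le1; lra.
have q0 : 0 <= p^-1 by rewrite invr_ge0; lra.
rewrite e; have : 0 <= S * p^-1 * B by rewrite !mulr_ge0.
have : 0 <= S * A * (1 - p^-1) by rewrite !mulr_ge0 // subr_ge0.
nra.
Qed.

(** (x (1 - x))^(-1/2) <= x^(-1/2) + (1 - x)^(-1/2), whose integral over (0, 1) is 4. *)
Lemma horner_increment_sqrt q (S : R) : 0 <= S ->
  (forall x, 0 < x < 1 -> x * q^`().[x] <= Num.sqrt (x / (1 - x)) * S) ->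
  q.[1] - q.[0] <= 4 * S.
Proof.
move=> S0 H.
pose g (x : R) := 2 * S * (Num.sqrt x - Num.sqrt (1 - x)).
pose dg (x : R) := S * ((Num.sqrt x)^-1 + (Num.sqrt (1 - x))^-1).
apply: (@le_trans _ _ (g 1 - g 0)); last first.
  by rewrite /g !subr0 !subrr sqrtr0 sqrtr1; lra.
apply: (@increment_le (horner q) g (fun x => q^`().[x]) dg) => // [x|||x].
- rewrite in_itv /= => /andP[x0 x1]; rewrite /g /dg.
  have y0 : 0 < 1 - x by rewrite subr_gt0.
  have d1 : is_derive x 1 (fun x : R => 1 - x) (-1).
    by rewrite -[-1]add0r; apply: is_deriveB.
  have d2 := is_derive1_sqrt y0.
  have d3 := is_derive1_comp (f := Num.sqrt) (g := fun x : R => 1 - x) d2 d1.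
  have d4 := is_derive1_sqrt x0.
  have := is_deriveZ (2 * S) (is_deriveB d4 d3).
  move=> D; apply: (is_derive_eq D); rewrite /GRing.scale /=.
  by field; rewrite !gt_eqF ?sqrtr_gt0.
- by apply: continuous_subspaceT; exact: continuous_horner.
- apply: continuous_subspaceT => x; apply: cvgM; first exact: cvg_cst.
  apply: cvgB; first exact: sqrt_continuous.
  apply: (@continuous_comp _ _ _ (fun x : R => 1 - x) Num.sqrt).
    by apply: cvgB; [exact: cvg_cst|exact: cvg_id].
  exact: sqrt_continuous.
rewrite in_itv /= => /andP[x0 x1].
have y0 : 0 < 1 - x by rewrite subr_gt0.
have /H : 0 < x < 1 by rewrite x0 x1.
have u0 : 0 < Num.sqrt x by rewrite sqrtr_gt0.
have v0 : 0 < Num.sqrt (1 - x) by rewrite sqrtr_gt0.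
have uE : Num.sqrt x ^+ 2 = x by rewrite sqr_sqrtr // ltW.
have vE : Num.sqrt (1 - x) ^+ 2 = 1 - x by rewrite sqr_sqrtr // ltW.
rewrite sqrtrM ?(ltW x0) // sqrtrV ?(ltW y0) // /dg.
set u := Num.sqrt x in u0 uE *; set v := Num.sqrt (1 - x) in v0 vE *.
move=> hx; rewrite -(ler_pM2l x0); apply: (le_trans hx).
have -> : x * (S * (u^-1 + v^-1)) = S * u * (u + v) / v.
  by rewrite -uE; field; rewrite !gt_eqF.
have -> : u / v * S = S * u * 1 / v by ring.
rewrite ler_pM2r ?invr_gt0 // ler_wpM2l ?mulr_ge0 ?(ltW u0) //.
have uv : 0 <= u + v by rewrite addr_ge0 ?ltW.
(* sqrt x + sqrt (1 - x) >= 1 *)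
rewrite -ler_sqr ?nnegrE // expr1n.
have -> : (u + v) ^+ 2 = 1 + 2 * (u * v) by rewrite sqrrD uE vE; ring.
by rewrite lerDl !mulr_ge0 ?ltW.
Qed.

End Analysis.

(** * Hypercontractivity *)

Section Hyper.
Variables (R : realType) (C : cplx R) (n : nat).
Local Notation M := 'M[C]_(qdim n).
Implicit Types (X Y Z : M) (i j : 'I_n) (r t : R) (s : seq 'I_n).

(** The fourth power of the Schatten 4-norm. *)
Definition fourth X : R := retr ((X ^t* *m X) ^t* *m (X ^t* *m X)).

Lemma fourth_ge0 X : 0 <= fourth X.
Proof. exact: retr_ge0. Qed.

Lemma sqZ r X : (r%:K *: X) ^t* *m (r%:K *: X) = (r ^+ 2)%:K *: (X ^t* *m X).
Proof. by rewrite ctZ -scalemxAl -scalemxAr scalerA -rmorphM. Qed.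

Lemma fourthZ r X : fourth (r%:K *: X) = r ^+ 4 * fourth X.
Proof. by rewrite /fourth sqZ sqZ retrZ -exprM. Qed.

Lemma fourth_ct X : fourth (X ^t*) = fourth X.
Proof.
by rewrite /fourth !ctM !trmxCK -[LHS]retr_ct !ctM !trmxCK -!mulmxA retrC -!mulmxA.
Qed.

Lemma retr_AMGM X Y :
  2 * retr (X ^t* *m Y) <= retr (X ^t* *m X) + retr (Y ^t* *m Y).
Proof.
have := retr_ge0 (X - Y); rewrite ctB mulmxBl !mulmxBr !retrB.
rewrite -[retr (Y ^t* *m X)]retr_ct ctM trmxCK; lra.
Qed.

Lemma off_orthogonal j Y Z : off j Z -> cexp j Y = 0 -> retr (Z ^t* *m Y) = 0.
Proof.
by move=> o e; rewrite -(cexp_fix o) cexp_sa e mulmx0 /retr mxtrace0 re0.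
Qed.

(** Expanding |X + Y|^2 = X* X + (X* Y + Y* X) + Y* Y and squaring, the term linear in Y
has trace 0, so the fourth norm behaves as in a 2-uniformly smooth space.  The
constant 5 comes from bounding every other cross term by Cauchy-Schwarz. *)
Lemma fourth_add_le j X Y : off j X -> cexp j Y = 0 ->
  fourth (X + Y) <= (Num.sqrt (fourth X) + 5 * Num.sqrt (fourth Y)) ^+ 2.
Proof.
move=> oX eY.
set P := X ^t* *m X; set T := X ^t* *m Y; set Q := Y ^t* *m Y.
have Pc : P ^t* = P by rewrite /P ctM trmxCK.
have Qc : Q ^t* = Q by rewrite /Q ctM trmxCK.
have oP : off j (P *m X ^t*) by apply: offM; [apply: offM|]; rewrite ?oX //; apply: off_ct.
have e0 : retr (P *m T) = 0.
  rewrite /T mulmxA -[P *m _]trmxCK; apply: (@off_orthogonal j) => //.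
  exact: off_ct.
have [S SE] : {S | S = T + T ^t*} by exists (T + T ^t*).
have XY : (X + Y) ^t* *m (X + Y) = P + S + Q.
  rewrite SE ctD mulmxDl !mulmxDr /P /T /Q ctM trmxCK.
  by rewrite !addrA.
have Sc : S ^t* = S by rewrite SE ctD trmxCK addrC.
have fourthE : fourth (X + Y) = fourth X + retr (S ^t* *m S) + fourth Y
    + 2 * retr (P *m S) + 2 * retr (P ^t* *m Q) + 2 * retr (S ^t* *m Q).
  rewrite /fourth -/P -/Q XY !ctD Pc Sc Qc !mulmxDl !mulmxDr !retrD.
  by rewrite (retrC S P) (retrC Q P) (retrC Q S); ring.
have PS : retr (P *m S) = 0.
  rewrite SE mulmxDr retrD e0 add0r -retr_ct ctM trmxCK Pc retrC.
  exact: e0.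
have SS : retr (S ^t* *m S) <= 4 * retr (T *m T ^t*).
  rewrite Sc SE mulmxDl !mulmxDr !retrD (retrC (T ^t*) T).
  have h := retr_AMGM (T ^t*) T; have h' := retr_AMGM T (T ^t*).
  by move: h h'; rewrite !trmxCK (retrC (T ^t*) T); lra.
have TT : retr (T *m T ^t*) <= Num.sqrt (fourth X) * Num.sqrt (fourth Y).
  have -> : retr (T *m T ^t*) = retr ((X *m X ^t*) ^t* *m (Y *m Y ^t*)).
    by rewrite /T !ctM !trmxCK -!mulmxA [RHS]retrC -!mulmxA.
  have := cauchy_schwarz (fun _ : 'I_1 => X *m X ^t*) (fun=> Y *m Y ^t*).
  rewrite !big_ord1; congr (_ <= Num.sqrt _ * Num.sqrt _).
    by have := fourth_ct X; rewrite /fourth trmxCK.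
  by have := fourth_ct Y; rewrite /fourth trmxCK.
have PQ : retr (P ^t* *m Q) <= Num.sqrt (fourth X) * Num.sqrt (fourth Y).
  by have := cauchy_schwarz (fun _ : 'I_1 => P) (fun=> Q); rewrite !big_ord1.
have SQ := retr_AMGM S Q; rewrite -/(fourth Y) in SQ.
set a := Num.sqrt (fourth X) in TT PQ *; set b := Num.sqrt (fourth Y) in TT PQ *.
have aE : fourth X = a ^+ 2 by rewrite sqr_sqrtr ?fourth_ge0.
have bE : fourth Y = b ^+ 2 by rewrite sqr_sqrtr ?fourth_ge0.
have -> : (a + 5 * b) ^+ 2 = a ^+ 2 + 10 * (a * b) + 25 * b ^+ 2 by ring.
have := sqr_ge0 b; rewrite bE in SQ; rewrite fourthE PS aE bE; lra.
Qed.

Lemma fourth_le_sqnorm_sq X : fourth X <= retr (X ^t* *m X) ^+ 2.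
Proof.
rewrite /fourth -gram1 gram_ct gram_udiag udiagM ?spectral_unitarymx //.
rewrite !retr_udiag ?spectral_unitarymx //.
set g := singv _.
rewrite expr2 mulr_suml; apply: ler_sum => i _.
apply: ler_wpM2l; first exact: sqr_ge0.
by rewrite (bigD1 i) //= lerDl; apply: sumr_ge0 => k _; exact: sqr_ge0.
Qed.

(** The two diagonal matrix units at j are exchanged by a partial isometry that commutes
with Z, and they sum to 1. *)
Lemma retr_site j Z : off j Z -> retr (site C j 0 0 *m Z) = 2^-1 * retr Z.
Proof.
move=> o; have e : retr (site C j 0 0 *m Z) = retr (site C j 1 1 *m Z).
  have -> : site C j 0 0 = site C j 0 1 *m site C j 1 0 by rewrite siteM eqxx scale1r.
  rewrite -mulmxA o mulmxA retrC mulmxA siteM eqxx scale1r.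
  by [].
have : retr Z = retr (site C j 0 0 *m Z) + retr (site C j 1 1 *m Z).
  rewrite -retrD -mulmxDl -{1}[Z]mul1mx -(sum_site C j).
  by rewrite !big_ord_recl big_ord0 addr0; congr (retr ((_ + _) *m _)); congr site; apply/val_inj.
by rewrite -e; lra.
Qed.

Lemma site_proj j Z : off j Z ->
  (site C j 0 0 *m Z) ^t* *m (site C j 0 0 *m Z) = site C j 0 0 *m (Z ^t* *m Z).
Proof.
move=> o; rewrite ctM site_ct -mulmxA (mulmxA (site _ _ _ _) (site _ _ _ _)).
by rewrite siteM eqxx scale1r !mulmxA (off_ct o).
Qed.

Lemma sqnorm_site j Z : off j Z ->
  retr ((site C j 0 0 *m Z) ^t* *m (site C j 0 0 *m Z)) = 2^-1 * retr (Z ^t* *m Z).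
Proof.
by move=> o; rewrite site_proj // retr_site //; apply: offM => //; apply: off_ct.
Qed.

Lemma fourth_site j Z : off j Z -> fourth (site C j 0 0 *m Z) = 2^-1 * fourth Z.
Proof.
move=> o; rewrite /fourth site_proj // sqnorm_site //.
by apply: offM => //; exact: off_ct.
Qed.

Lemma smooth_site r s j X : j \notin s ->
  smooth r s (site C j 0 0 *m X) = site C j 0 0 *m smooth r s X.
Proof.
elim: s => //= i s IH; rewrite inE negb_or => /andP[ji /IH ->].
have o : off i (site C j 0 0) by apply: off_site; rewrite eq_sym.
rewrite !depolE !cdifE cexp_modl // mulmxDr -scalemxAr.
by congr (_ + _ *: _); rewrite mulmxBr.
Qed.

Lemma retr_pyth j X : retr (X ^t* *m X) =
  retr ((cexp j X) ^t* *m cexp j X) + retr ((cdif j X) ^t* *m cdif j X).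
Proof.
rewrite cexp_sa cdif_sa cexp_idem cdif_idem -retrD -mulmxDr.
by rewrite cdifE addrC subrK.
Qed.

Lemma off_smooth r s j X : off j X -> off j (smooth r s X).
Proof. by move=> o; rewrite -(cexp_fix o) -cexp_smooth; exact: off_cexp. Qed.

(** Induction over the sites, for the trace normalised on the sites already treated.
Split X = a + D with a = tau_j X and D = d_j X.  For a the new normalisation factor
2 is gained by applying the induction hypothesis to the corner e_00 a, which
carries half of both norms; for D it is lost, and the factor 1/3 pays for this:
5 sqrt 2 / 9 <= 1 in the smoothness inequality. *)
Lemma hypercontractive s X : uniq s ->
  2 ^+ size s * fourth (smooth 3^-1 s X) <= retr (X ^t* *m X) ^+ 2.
Proof.
elim: s X => [|j s IH] X /=; first by rewrite mul1r => _; exact: fourth_le_sqnorm_sq.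
move=> /andP[js us]; rewrite depolE cexp_smooth cdif_smooth.
set a := cexp j X; set D := cdif j X; set k : R := 2 ^+ size s.
have oa : off j a by exact: off_cexp.
have k0 : 0 < k by rewrite exprn_gt0.
have hD := IH D us.
have ha := IH (site C j 0 0 *m a) us.
rewrite smooth_site // fourth_site ?sqnorm_site // in ha; last exact: off_smooth.
have h := @fourth_add_le j (smooth 3^-1 s a) (3^-1%:K *: smooth 3^-1 s D) (off_smooth _ _ oa) _.
rewrite exprS; apply: (@le_trans _ _ (2 * k * (Num.sqrt (fourth (smooth 3^-1 s a)) +
     5 * Num.sqrt (fourth (3^-1%:K *: smooth 3^-1 s D))) ^+ 2)).
  apply: ler_wpM2l; first by rewrite mulr_ge0 // ltW.
  apply: h; rewrite cexpZ cexp_smooth cexp_cdif.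
  by rewrite -(scale0r (0 : M)) smoothZ !scale0r scaler0.
rewrite (retr_pyth j) -/a -/D fourthZ.
set na := retr (a ^t* *m a) in ha *; set nD := retr (D ^t* *m D) in hD *.
have na0 : 0 <= na by exact: retr_ge0.
have nD0 : 0 <= nD by exact: retr_ge0.
have -> : 3^-1 ^+ 4 = (3^-1 ^+ 2) ^+ 2 :> R by rewrite -exprM.
rewrite sqrtrM ?sqr_ge0 // sqrtr_sqr ger0_norm ?sqr_ge0 //.
set u := Num.sqrt (fourth _); set v := Num.sqrt (fourth _).
have u0 : 0 <= u by exact: sqrtr_ge0.
have v0 : 0 <= v by exact: sqrtr_ge0.
have uE : u ^+ 2 = fourth (smooth 3^-1 s a) by rewrite sqr_sqrtr ?fourth_ge0.
have vE : v ^+ 2 = fourth (smooth 3^-1 s D) by rewrite sqr_sqrtr ?fourth_ge0.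
rewrite -uE in ha; rewrite -vE in hD.
set w := Num.sqrt k.
have w0 : 0 < w by rewrite sqrtr_gt0.
have wE : w ^+ 2 = k by rewrite sqr_sqrtr // ltW.
set q := Num.sqrt 2 : R.
have q0 : 0 < q by rewrite sqrtr_gt0.
have qE : q ^+ 2 = 2 by rewrite sqr_sqrtr.
have hv : w * v <= nD.
  by rewrite -ler_sqr ?nnegrE ?mulr_ge0 ?(ltW w0) // exprMn wE.
have hu : q * w * u <= na.
  rewrite -ler_sqr ?nnegrE ?mulr_ge0 ?(ltW w0) ?(ltW q0) // !exprMn wE qE.
  have {}ha : k * (2^-1 * u ^+ 2) <= (2^-1 * na) ^+ 2 by exact: ha.
  by move: (k) (u ^+ 2) ha => k1 u1 ha; nra.
have -> : 2 * k * (u + 5 * (3^-1 ^+ 2 * v)) ^+ 2 =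
    (q * w * u + 5 / 9 * q * (w * v)) ^+ 2.
  by rewrite -qE -wE; field.
have q3 : q <= 9 / 5.
  rewrite -ler_sqr ?nnegrE ?(ltW q0) // qE; lra.
rewrite ler_sqr ?nnegrE ?addr_ge0 ?mulr_ge0 ?(ltW w0) ?(ltW q0) //.
apply: lerD => //.
apply: (@le_trans _ _ (1 * (w * v))); last by rewrite mul1r.
apply: ler_wpM2r; first by rewrite mulr_ge0 // ltW.
lra.
Qed.

End Hyper.

(** * Gradient, trace-norm and low-frequency estimates *)

Section Estimates.
Variables (R : realType) (C : cplx R) (n : nat).
Local Notation M := 'M[C]_(qdim n).
Implicit Types (A X Y Z : M) (i j : 'I_n) (r t : R).

Definition heat r X : M := smooth r (enum 'I_n) X.

Definition grad X (j : 'I_n) : M := cdif j X.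

Definition heatcorr X Y : {poly R} := corr (enum 'I_n) X Y.

Definition sqnorm X : R := retr (X ^t* *m X).

Lemma sqnorm_ge0 X : 0 <= sqnorm X. Proof. exact: retr_ge0. Qed.

Lemma heatcorrE X Y r : (heatcorr X Y).[r] = retr (X ^t* *m heat r Y).
Proof. exact: corrE. Qed.

Lemma heatcorr_sqnorm r X : sqnorm (heat r X) = (heatcorr X X).[r ^+ 2].
Proof. by rewrite heatcorrE /sqnorm /heat smooth_sa smoothM. Qed.

Lemma heatcorr_ge0 X r : 0 <= r -> 0 <= (heatcorr X X).[r].
Proof.
move=> r0; rewrite horner_coef; apply: sumr_ge0 => i _.
by rewrite mulr_ge0 ?exprn_ge0 //; exact: corr_ge0.
Qed.

Lemma heatcorr_deriv X Y r :
  r * (heatcorr X Y)^`().[r] = \sum_j retr ((grad X j) ^t* *m grad (heat r Y) j).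
Proof.
have -> : r * (heatcorr X Y)^`().[r] = ('X * (heatcorr X Y)^`()).[r].
  by rewrite hornerM hornerX.
rewrite corr_deriv horner_sum big_enum; apply: eq_bigr => j _.
by rewrite corrE /grad /heat cdif_smooth.
Qed.

Lemma sqnorm_grad_heat X r :
  retr (gram (grad (heat r X))) = r ^+ 2 * (heatcorr X X)^`().[r ^+ 2].
Proof.
rewrite heatcorr_deriv /gram retr_sum; apply: eq_bigr => j _.
by rewrite /grad /heat !cdif_smooth smooth_sa smoothM.
Qed.

Lemma hornerX_deriv_coef (q : {poly R}) r :
  r * q^`().[r] = \sum_(k < size q) q`_k * (k%:R * r ^+ k).
Proof.
have -> : r * q^`().[r] = ('X * q^`()).[r] by rewrite hornerM hornerX.
have sz : (size ('X * q^`())%R <= size q)%N.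
  have [->|q0] := eqVneq q 0; first by rewrite deriv0 mulr0 size_poly0.
  apply: leq_trans (size_polyMleq _ _) _; rewrite size_polyX /=.
  by apply: lt_size_deriv.
rewrite (horner_coef_wide _ sz); apply: eq_bigr => -[k /= _] _.
rewrite coefXM coef_deriv mulrA; congr (_ * _).
by case: k => [|k] /=; rewrite ?mulr0 // mulr_natr.
Qed.

Lemma heatcorr_coef X r : (heatcorr X X).[r] =
  \sum_(k < size (heatcorr X X)) (heatcorr X X)`_k * r ^+ k.
Proof. exact: horner_coef. Qed.

Lemma deriv_homo X r t : 0 <= r <= t ->
  r * (heatcorr X X)^`().[r] <= t * (heatcorr X X)^`().[t].
Proof.
move=> /andP[r0 rt]; rewrite !hornerX_deriv_coef; apply: ler_sum => k _.
apply: ler_wpM2l; first exact: corr_ge0.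
by rewrite ler_wpM2l // lerXn2r ?nnegrE // (le_trans r0).
Qed.

(** From [smooth_gradient] and P_r (A* A) <= 1. *)
Lemma gradient_bound r A : 0 <= r < 1 -> psd (1%:M - A ^t* *m A) ->
  psd ((r / (1 - r))%:K *: 1%:M - gram (grad (heat r A))).
Proof.
move=> /andP[r0 r1] hA.
have hr : 0 <= r <= 1 by rewrite r0 ltW.
have y0 : 0 < 1 - r by rewrite subr_gt0.
have h1 := smooth_gradient (enum 'I_n) A hr.
have h2 := psdZ r0 (smooth_psd (enum 'I_n) hr hA).
have h3 := psdZ r0 (psd_sq (heat r A)).
have y1 : 0 <= (1 - r)^-1 by rewrite invr_ge0 ltW.
have := psdZ y1 (psdD (psdD h1 h2) h3).
rewrite smoothB smooth1 big_enum /= -/(heat r A) -/(heat r (A ^t* *m A)).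
rewrite /gram /grad; set G := \sum_j _; set B := (heat r A) ^t* *m _; set H := heat r _.
congr psd; rewrite !(scalerDr, scalerN, scalerBr) !scalerA -!rmorphM mulVf ?gt_eqF //.
rewrite rmorph1 scale1r [_^-1 * r]mulrC.
by mxring.
Qed.

Definition pnorm (p : R) (I : finType) (X : I -> M) : R := \sum_i singv X i `^ p.

Lemma pnorm_ge0 p (I : finType) (X : I -> M) : 0 <= pnorm p X.
Proof. by apply: sumr_ge0 => i _; exact: powR_ge0. Qed.

(** The quadratic term produced by [col_pairing_pow] is half of r^2 w'(r^2), and r w'(r) is
nondecreasing, so it is absorbed by half of the left-hand side. *)
Lemma heat_energy A p r : 1 <= p <= 2 -> 0 < r < 1 -> psd (1%:M - A ^t* *m A) ->
  r * (heatcorr A A)^`().[r] <= 2 * (r / (1 - r)) `^ (1 - p / 2) * pnorm p (grad A).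
Proof.
move=> hp /andP[r0 r1] hA.
have K0 : 0 < r / (1 - r) by rewrite divr_gt0 // subr_gt0.
have hr : 0 <= r < 1 by rewrite ltW.
have := col_pairing_pow (grad A) hp K0 (gradient_bound hr hA).
rewrite -heatcorr_deriv sqnorm_grad_heat -/(pnorm p (grad A)).
have := @deriv_homo A (r ^+ 2) r.
rewrite sqr_ge0 expr2 ler_piMl ?(ltW r0) ?(ltW r1) // => /(_ isT).
set a := r * _; set b := _ * _; lra.
Qed.

Lemma heat_tail A p r : 1 <= p <= 2 -> 2^-1 <= r <= 1 -> psd (1%:M - A ^t* *m A) ->
  (heatcorr A A).[1] - (heatcorr A A).[r] <= 8 * (1 - r) `^ (p / 2) * pnorm p (grad A).
Proof.
move=> hp hr hA; apply: horner_increment_pow => // [|x /andP[x2 x1]].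
  exact: pnorm_ge0.
by apply: heat_energy => //; rewrite x1 andbT; lra.
Qed.

Lemma tnorm_dual X V : psd (1%:M - V ^t* *m V) -> retr (X ^t* *m V) <= tnorm (single X).
Proof.
move=> h; have := @col_pairing_inf _ _ _ _ (single X) (single V) 1.
by rewrite big_ord1 sqrtr1 mul1r gram1 rmorph1 scale1r; apply.
Qed.

(** By duality with a contraction V: the derivative of r |-> tr (A* P_r V) is a pairing of
grad A with the column grad (P_r V), whose operator norm is at most
sqrt (r / (1 - r)). *)
Lemma l1_poincare A : tnorm (single (A - heat 0 A)) <= 4 * tnorm (grad A).
Proof.
have [V [hV <-]] := tnorm_attained (A - heat 0 A).
have -> : retr ((A - heat 0 A) ^t* *m V) = (heatcorr A V).[1] - (heatcorr A V).[0].
  by rewrite ctB mulmxBl retrB !heatcorrE /heat smooth1r smooth_sa.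
apply: horner_increment_sqrt => [|x /andP[x0 x1]]; first exact: tnorm_ge0.
rewrite heatcorr_deriv; apply: col_pairing_inf; apply: gradient_bound => //.
by rewrite x1 ltW.
Qed.

Lemma heat_contractive r V : 0 <= r <= 1 -> psd (1%:M - V ^t* *m V) ->
  psd (1%:M - (heat r V) ^t* *m heat r V).
Proof.
move=> hr hV.
have := psdD (smooth_psd (enum 'I_n) hr hV) (smooth_ks (enum 'I_n) V hr).
by rewrite smoothB smooth1 addrA subrK.
Qed.

(** Dual to the contractivity of the semigroup in operator norm. *)
Lemma tnorm_heat r X : 0 <= r <= 1 -> tnorm (single (heat r X)) <= tnorm (single X).
Proof.
move=> hr; have [V [hV <-]] := tnorm_attained (heat r X).
by rewrite smooth_sa; apply: tnorm_dual; exact: heat_contractive.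
Qed.

(** Duality: with Y = P_(1/3) X and Z = P_(1/3) Y, tr (X* Z) = tr (Y* Y), while the fourth norm of Z
is at most the second norm of Y; insert this in [pairing_fourth] and divide. *)
Lemma heat_hyper X :
  Num.sqrt (2 ^+ n) * (heatcorr X X).[9^-1] <= tnorm (single X) * Num.sqrt (sqnorm X).
Proof.
have e : (heatcorr X X).[9^-1] = sqnorm (heat 3^-1 X).
  by rewrite heatcorr_sqnorm; congr (_.[_]); rewrite exprVn; congr (_^-1); ring.
rewrite e; set Y := heat 3^-1 X; set b := sqnorm Y.
have b0 : 0 <= b by exact: sqnorm_ge0.
have [->|bN] := eqVneq b 0.
  by rewrite mulr0 mulr_ge0 ?sqrtr_ge0 ?tnorm_ge0.
have bp : 0 < b by rewrite lt_def bN.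
have h4 := hypercontractive Y (enum_uniq 'I_n).
rewrite size_enum_ord -/(heat _ _) -/(sqnorm Y) -/b in h4.
have := pairing_fourth X (heat 3^-1 Y).
rewrite -[heat 3^-1 Y]/(smooth _ _ _) -smooth_sa -/(heat _ _) -/Y -/(sqnorm Y) -/b -/(sqnorm X) -/(fourth _) -/(tnorm _).
set T := tnorm _; set x := Num.sqrt (sqnorm X); set y := Num.sqrt (fourth _); set w := Num.sqrt _.
have w0 : 0 < w by rewrite sqrtr_gt0 exprn_gt0.
have y0 : 0 <= y by exact: sqrtr_ge0.
have x0 : 0 <= x by exact: sqrtr_ge0.
have T0 : 0 <= T by exact: tnorm_ge0.
have wy : w * y <= b.
  rewrite -ler_sqr ?nnegrE ?mulr_ge0 ?(ltW w0) // exprMn.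
  by rewrite sqr_sqrtr ?exprn_ge0 // sqr_sqrtr ?fourth_ge0.
move=> h; rewrite -(ler_pM2r bp).
have : w * b ^+ 2 <= w * (T * (x * y)) by rewrite ler_wpM2l // ltW.
have : T * x * (w * y) <= T * x * b by rewrite ler_wpM2l // mulr_ge0.
by rewrite expr2; lra.
Qed.

Lemma heatcorr_centre X r :
  (heatcorr (X - heat 0 X) (X - heat 0 X)).[r] = (heatcorr X X).[r] - (heatcorr X X).[0].
Proof.
rewrite !heatcorrE {2}/heat smoothB smoothM mulr0 -/(heat r X) -/(heat 0 X).
rewrite ctB mulmxBl !mulmxBr !retrB !(smooth_sa 0) smoothM mul0r smoothM mul0r.
by rewrite subrr subr0.
Qed.

Lemma heatcorr0_le X r : 0 <= r -> (heatcorr X X).[0] <= (heatcorr X X).[r].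
Proof.
move=> r0; rewrite !heatcorr_coef; apply: ler_sum => k _.
apply: ler_wpM2l; first exact: corr_ge0.
by apply: lerXn2r; rewrite ?nnegrE.
Qed.

Lemma low_le_deriv X r : 0 <= r ->
  (heatcorr X X).[r] - (heatcorr X X).[0] <= r * (heatcorr X X)^`().[r].
Proof.
move=> r0; rewrite hornerX_deriv_coef !heatcorr_coef -sumrB; apply: ler_sum => k _.
rewrite -mulrBr; apply: ler_wpM2l; first exact: corr_ge0.
case: (val k) => [|l] /=; first by rewrite !expr0 subrr mul0r.
by rewrite expr0n subr0 ler_peMl ?exprn_ge0 // ler1n.
Qed.

(** k / 4^k <= 1 for every level k >= 1. *)
Lemma deriv_le_var X : 4^-1 * (heatcorr X X)^`().[4^-1] <=
  (heatcorr X X).[1] - (heatcorr X X).[0].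
Proof.
rewrite hornerX_deriv_coef !heatcorr_coef -sumrB; apply: ler_sum => k _.
rewrite -mulrBr; apply: ler_wpM2l; first exact: corr_ge0.
rewrite expr1n; case: (val k) => [|l] /=; first by rewrite mul0r subrr.
rewrite expr0n subr0 exprVn ler_pdivrMr ?exprn_gt0 // mul1r -natrX ler_nat.
by apply: ltnW; apply: ltn_expl.
Qed.

(** Level k is counted k times in sum_j, and 1/36 = (1/2)^2 (1/9).  The factor 1/9 is
spent on [heat_hyper]; the factor (1/2)^2 makes the squared second norms of the
P_(1/2) d_j A add up to at most the variance, whereas those of the d_j A add up
to the total influence, which need not be small. *)
Lemma low_le_influence X :
  Num.sqrt (2 ^+ n) * ((heatcorr X X).[36^-1] - (heatcorr X X).[0]) <=
  Num.sqrt (\sum_j tnorm (single (grad X j)) ^+ 2) *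
  Num.sqrt ((heatcorr X X).[1] - (heatcorr X X).[0]).
Proof.
set w := Num.sqrt (2 ^+ n).
have w0 : 0 <= w by exact: sqrtr_ge0.
have k0 : 0 <= (36^-1 : R) by rewrite invr_ge0.
apply: le_trans (ler_wpM2l w0 (low_le_deriv X k0)) _.
rewrite heatcorr_deriv mulr_sumr.
apply: (@le_trans _ _ (\sum_j tnorm (single (grad X j)) *
    Num.sqrt (sqnorm (heat 2^-1 (grad X j))))).
  apply: ler_sum => j _.
  have -> : retr ((grad X j) ^t* *m grad (heat 36^-1 X) j) =
      (heatcorr (heat 2^-1 (grad X j)) (heat 2^-1 (grad X j))).[9^-1].
    rewrite heatcorrE /heat smoothM smooth_sa smoothM /grad cdif_smooth.
    by congr (retr (_ *m smooth _ _ _)); field.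
  apply: le_trans (heat_hyper _) _.
  apply: ler_wpM2r; first exact: sqrtr_ge0.
  by apply: tnorm_heat; apply/andP; split; lra.
apply: le_trans (real_cauchy_schwarz (fun j => tnorm (single (grad X j)))
  (fun j => Num.sqrt (sqnorm (heat 2^-1 (grad X j))))) _.
apply: ler_wpM2l; first exact: sqrtr_ge0.
apply: ler_wsqrtr.
under eq_bigr => j _ do rewrite sqr_sqrtr ?sqnorm_ge0 //.
apply: le_trans (deriv_le_var X).
have -> : 4^-1 = 2^-1 ^+ 2 :> R by rewrite exprVn; congr (_^-1); ring.
rewrite -sqnorm_grad_heat /gram retr_sum; apply: ler_sum => j _.
by rewrite /grad /heat cdif_smooth.
Qed.

End Estimates.

(** * The completely mixed limit *)

Section Scalar.
Variables (R : realType) (C : cplx R) (n : nat).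
Local Notation M := 'M[C]_(qdim n).
Implicit Types (X Y Z A : M) (x y z : word n) (i j : 'I_n).

Lemma ent_cexp j X x y : ent (cexp j X) x y =
  if x j == y j then 2^-1 * \sum_(b < 2) ent X (setbit j x b) (setbit j y b) else 0.
Proof.
rewrite cexpE; set S := \sum_a _.
have -> : ent (2^-1%:K *: S) x y = 2^-1 * ent S x y.
  by rewrite /ent mxE fmorphV rmorph_nat.
have -> : ent S x y = \sum_a \sum_b (x j == b)%:R * ((y j == b)%:R *
    ent X (setbit j x a) (setbit j y a)).
  rewrite /S {1}/ent summxE; apply: eq_bigr => a _.
  rewrite summxE; apply: eq_bigr => b _.
  by rewrite -/(ent _ x y) site_ct -mulmxA ent_sitel ent_siter.
under eq_bigr => a _.
  rewrite (bigD1 (x j)) //= eqxx mul1r big1 => [|b bx]; last first.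
    by rewrite eq_sym (negPf bx) mul0r.
  rewrite addr0; over.
case: eqVneq => [_|_].
  by congr (_ * _); apply: eq_bigr => a _; rewrite mul1r.
by rewrite big1 ?mulr0 // => a _; rewrite mul0r.
Qed.

Lemma mxtrace_cexp j X : \tr (cexp j X) = \tr X.
Proof.
rewrite cexpE mxtraceZ raddf_sum /=.
have -> : \sum_a \tr (\sum_b (site C j a b) ^t* *m X *m site C j a b) =
    \tr (X *m \sum_a \sum_b (site C j b a) ^t* *m site C j b a).
  rewrite mulmx_sumr raddf_sum /=; apply: eq_bigr => a _.
  rewrite mulmx_sumr !raddf_sum /=; apply: eq_bigr => b _.
  by rewrite !site_ct -!mulmxA mxtrace_mulC -mulmxA.
rewrite exchange_big sum_site_ctl -scalemx1 -scalemxAr mulmx1 mxtraceZ mulrA.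
by rewrite -rmorphM mulVf ?pnatr_eq0 // rmorph1 mul1r.
Qed.

(** Commuting with all matrix units at j forces the entries of Z to vanish between words that
differ at j and to be invariant under changing the letter j of both words. *)
Lemma off_all_scalar Z : (forall j, off j Z) -> Z = ((2 ^+ n)^-1 * \tr Z)%:M.
Proof.
move=> o.
have e j a b x y : (x j == a)%:R * ent Z (setbit j x b) y =
    (y j == b)%:R * ent Z x (setbit j y a).
  by rewrite -ent_sitel o ent_siter.
have offd x y : x != y -> ent Z x y = 0.
  move=> xy; have [j xj] : exists j, x j != y j.
    apply/existsP; apply: contraNT xy => /existsPn h.
    by apply/eqP/ffunP => k; apply/eqP; have := h k; rewrite negbK.
  have := e j (x j) (x j) x y.
  by rewrite eqxx mul1r setbit_id eq_sym (negPf xj) mul0r.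
have diag j b x : ent Z (setbit j x b) (setbit j x b) = ent Z x x.
  have := e j (x j) b x (setbit j x b).
  by rewrite eqxx setbit_at eqxx !mul1r setbit_setbit setbit_id.
pose x0 : word n := [ffun=> 0].
have diag0 y : ent Z y y = ent Z x0 x0.
  pose w s := foldr (fun j z => setbit j z (y j)) x0 s.
  have -> : y = w (enum 'I_n).
    have H s k : w s k = if k \in s then y k else x0 k.
      elim: s => //= i s IH; rewrite ffunE inE; case: eqVneq => [->//|ki] /=.
      exact: IH.
    by apply/ffunP => k; rewrite H mem_enum.
  by elim: (enum 'I_n) => //= j s IH; rewrite diag.
have ZE : Z = (ent Z x0 x0)%:M.
  apply: ent_inj => x y; rewrite {2}/ent mxE (inj_eq enum_rank_inj).
  have [->|xy] := eqVneq x y; first by rewrite mulr1n diag0.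
  by rewrite mulr0n offd.
rewrite {1}ZE; congr (_%:M); rewrite [in RHS]ZE mxtrace_scalar -[_ *+ qdim n]mulr_natl.
have -> : (qdim n)%:R = 2 ^+ n :> C by rewrite qdimE natrX.
by rewrite mulKf // expf_neq0 // pnatr_eq0.
Qed.

Lemma mxtrace_heat0 X : \tr (heat 0 X) = \tr X.
Proof.
rewrite /heat; elim: (enum 'I_n) => //= j s IH.
by rewrite depolE rmorph0 scale0r addr0 mxtrace_cexp.
Qed.

Lemma heat0E X : heat 0 X = ((2 ^+ n)^-1 * \tr X)%:M.
Proof.
rewrite -(mxtrace_heat0 X); apply: off_all_scalar => j.
suff <- : cexp j (heat 0 X) = heat 0 X by exact: off_cexp.
apply/eqP; rewrite eq_sym -subr_eq0 -cdifE; apply/eqP.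
have : j \in enum 'I_n by rewrite mem_enum.
rewrite /heat; elim: (enum 'I_n) => //= i s IH; rewrite inE => /predU1P[->|/IH e].
  by rewrite cdif_depol depolE rmorph0 scale0r addr0 cexp_cdif.
by rewrite cdif_depol e -(scale0r (0 : M)) depolZ !scale0r.
Qed.

End Scalar.

(** * Functional calculus and the operator norm *)

Section Norms.
Variables (R : realType) (C : cplx R) (m : nat).
Local Notation M := 'M[C]_m.
Implicit Types (X Y Z A H : M).

Definition hfun (f : R -> R) H : M :=
  invmx (spectralmx H)
    *m diag_mx (map_mx (fun z : C => (f (re z))%:K) (spectral_diag H))
    *m spectralmx H.

Lemma hfun_udiag (U : M) d (f : R -> R) : U \is unitarymx ->
  hfun f (udiag U d) = udiag U (f \o d).
Proof.
move=> Uu; have E := spectral_udiag (ct_udiag U d).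
rewrite -(udiag_fun f Uu (spectral_unitarymx _) E) /hfun /udiag.
rewrite invmx_unitary ?spectral_unitarymx //.
by congr (_ *m diag_mx _ *m _); apply/rowP => i; rewrite !mxE.
Qed.

Definition habs X := hfun Num.sqrt (X ^t* *m X).

Lemma hfun_gram (I : finType) (X : I -> M) :
  hfun Num.sqrt (gram X) = udiag (spectralmx (gram X)) (singv X).
Proof.
rewrite {1}gram_udiag hfun_udiag ?spectral_unitarymx //; apply: udiagE => i /=.
by rewrite sqrtr_sqr ger0_norm ?singv_ge0.
Qed.

Lemma habs_udiag (U : M) d : U \is unitarymx -> (forall i, 0 <= d i) ->
  habs (udiag U d) = udiag U d.
Proof.
move=> Uu d0; rewrite /habs ct_udiag udiagM // hfun_udiag //; apply: udiagE => i /=.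
by rewrite -expr2 sqrtr_sqr ger0_norm.
Qed.

Lemma habs_sq X : habs X *m habs X = X ^t* *m X.
Proof.
rewrite /habs -gram1 hfun_gram udiagM ?spectral_unitarymx // [RHS]gram_udiag.
by apply: udiagE => i; rewrite expr2.
Qed.

Lemma retr_hfun_habs (f : R -> R) X :
  retr (hfun f (habs X)) = \sum_i f (singv (single X) i).
Proof.
rewrite /habs -gram1 hfun_gram hfun_udiag ?spectral_unitarymx //.
by rewrite retr_udiag ?spectral_unitarymx.
Qed.

Lemma retr_hfun_habs_grad (f : R -> R) (I : finType) (X : I -> M) :
  retr (hfun f (habs (hfun Num.sqrt (\sum_j habs (X j) *m habs (X j))))) =
  \sum_i f (singv X i).
Proof.
under eq_bigr => j _ do rewrite habs_sq.
rewrite -/(gram X) hfun_gram habs_udiag ?spectral_unitarymx //; last first.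
  by move=> i; exact: singv_ge0.
by rewrite hfun_udiag ?spectral_unitarymx // retr_udiag ?spectral_unitarymx.
Qed.

(** Uniqueness of the positive square root of X* X. *)
Lemma tnorm_unique X H : psd H -> H ^t* = H -> H *m H = X ^t* *m X ->
  tnorm (single X) = retr H.
Proof.
move=> Hp Hc HH.
have Vu := spectral_unitarymx H; set V := spectralmx H in Vu.
have HE := spectral_udiag Hc; rewrite -/V in HE.
set h := (fun i => _) in HE.
have h0 i : 0 <= h i by rewrite -(quad_udiag h i Vu) -HE; exact: Hp.
have E : udiag V (fun i => h i * h i) = udiag (spectralmx (gram (single X)))
    (fun i => singv (single X) i ^+ 2).
  by rewrite -udiagM // -HE HH -gram1 -gram_udiag.
have := udiag_fun Num.sqrt Vu (spectral_unitarymx _) E.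
move=> /(congr1 (@retr _ _ _)); rewrite !retr_udiag ?spectral_unitarymx //=.
under eq_bigr => i _ do rewrite sqrtr_sqr ger0_norm ?singv_ge0 //.
under [in RHS]eq_bigr => i _ do rewrite -expr2 sqrtr_sqr ger0_norm ?h0 //.
by rewrite -/(tnorm _) => ->; rewrite [in RHS]HE retr_udiag.
Qed.

Definition enorm (v : 'cV[C]_m) : R := Num.sqrt (\sum_i re (`|v i 0| ^+ 2)).

Lemma enormE v : enorm v = Num.sqrt (retr (v ^t* *m v)).
Proof.
rewrite /enorm; congr Num.sqrt; rewrite /retr /mxtrace big_ord1 mxE re_sum.
by apply: eq_bigr => i _; rewrite !mxE normCK mulrC.
Qed.

Lemma udiagZ (U : M) r d : udiag U (fun i => r * d i) = r%:K *: udiag U d.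
Proof.
rewrite /udiag scalemxAl scalemxAr -linearZ /=; congr (_ *m diag_mx _ *m _).
by apply/rowP => i; rewrite !mxE rmorphM.
Qed.

(** The supremum defining the operator norm bounds |A v| only if the set is bounded above; the
Hilbert-Schmidt norm of A provides a bound. *)
Lemma psd_opnorm A : sup [set enorm (A *m v) | v in [set v | enorm v = 1]] <= 1 ->
  psd (1%:M - A ^t* *m A).
Proof.
move=> hA u; rewrite quadB quadM subr_ge0.
have -> : quad 1%:M u = retr (u ^t* *m u) by rewrite /quad mulmx1.
pose K := \sum_i singv (single A) i ^+ 2.
have hK (v : 'cV[C]_m) : retr ((A *m v) ^t* *m (A *m v)) <= K * retr (v ^t* *m v).
  have : psd (K%:K *: 1%:M - A ^t* *m A).
    have -> : K%:K *: 1%:M - A ^t* *m A = udiag (spectralmx (gram (single A)))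
        (fun i => K - singv (single A) i ^+ 2).
      rewrite -udiagB -gram_udiag -[in LHS]gram1; congr (_ - _).
      rewrite -(udiag1 (spectral_unitarymx (gram (single A)))) -udiagZ.
      by apply: udiagE => i; rewrite mulr1.
    apply: psd_udiag => i; rewrite subr_ge0 /K (bigD1 i) //= lerDl.
    by apply: sumr_ge0 => k _; exact: sqr_ge0.
  move=> /(_ v); rewrite quadB quadZ quadM subr_ge0.
  by rewrite /quad mulmx1.
have n0 := retr_ge0 u.
have [u0|uN] := eqVneq (retr (u ^t* *m u)) 0.
  by have := hK u; rewrite u0 mulr0.
set N := Num.sqrt (retr (u ^t* *m u)).
have N0 : 0 < N by rewrite sqrtr_gt0 lt_def uN.
have NE : N ^+ 2 = retr (u ^t* *m u) by rewrite sqr_sqrtr.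
have sc (B : 'M[C]_m) : retr ((B *m (N^-1%:K *: u)) ^t* *m (B *m (N^-1%:K *: u))) =
    N ^- 2 * retr ((B *m u) ^t* *m (B *m u)).
  rewrite -scalemxAr ctZ -scalemxAl -scalemxAr !retrZ mulrA.
  by congr (_ * _); rewrite -expr2 exprVn.
have e1 : enorm (N^-1%:K *: u) = 1.
  have := sc 1%:M; rewrite !mul1mx enormE => ->.
  by rewrite -NE mulVf ?sqrtr1 // expf_neq0 // gt_eqF.
have : enorm (A *m (N^-1%:K *: u)) <= 1.
  apply: le_trans hA; apply: ub_le_sup; last by exists (N^-1%:K *: u).
  exists (Num.sqrt K) => _ [v /= v1 <-]; rewrite enormE ler_wsqrtr //.
  apply: (le_trans (hK v)).
  have : retr (v ^t* *m v) = 1.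
    by rewrite -[LHS]sqr_sqrtr ?retr_ge0 // -enormE v1 expr1n.
  by move=> ->; rewrite mulr1.
rewrite enormE sc -[leRHS]sqrtr1 ler_psqrt ?nnegrE ?ler01 //; last first.
  by rewrite mulr_ge0 ?retr_ge0 // invr_ge0 sqr_ge0.
by rewrite mulrC ler_pdivrMr ?mul1r ?exprn_gt0 // NE.
Qed.

End Norms.

(** * Cutting the spectrum at a given level *)

Section Cutoff.
Variables (R : realType) (C : cplx R) (n : nat).
Local Notation M := 'M[C]_(qdim n).
Implicit Types (A X : M) (p r : R).

Lemma bernoulli_le (x : R) d : 0 <= x -> 1 + d%:R * x <= (1 + x) ^+ d.
Proof.
move=> x0; elim: d => [|d IH]; first by rewrite mul0r addr0 expr0.
rewrite exprS; apply: le_trans (ler_wpM2l (addr_ge0 ler01 x0) IH).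
have : 0 <= d%:R * x ^+ 2 by rewrite mulr_ge0 ?sqr_ge0.
by rewrite -natr1; lra.
Qed.

Lemma pow_cutoff (d k : nat) : (0 < d)%N -> (d <= k)%N ->
  (1 - (2 * d%:R)^-1) ^+ k <= 2 / 3 :> R.
Proof.
move=> d0 dk; set x : R := (2 * d%:R)^-1.
have d1 : 1 <= d%:R :> R by rewrite ler1n.
have x0 : 0 < x by rewrite invr_gt0; lra.
have dx : d%:R * x = 2^-1 by rewrite /x; field; lra.
have x1 : x <= 2^-1 by rewrite -dx ler_peMl // ltW.
have y0 : 0 <= 1 - x by lra.
apply: (@le_trans _ _ ((1 - x) ^+ d)).
  by apply: ler_wiXn2l => //; lra.
have B := bernoulli_le d (ltW x0); rewrite dx in B.
have P : (1 - x) ^+ d * (1 + x) ^+ d <= 1.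
  rewrite -exprMn; apply: exprn_ile1; first by rewrite mulr_ge0 //; lra.
  by have := sqr_ge0 x; lra.
have z0 : 0 <= (1 - x) ^+ d by rewrite exprn_ge0.
have := ler_wpM2l z0 B; lra.
Qed.

(** Level by level: for k <= d the first term is at least 1, for k >= d the factor
1 - (1 - 1/(2d))^k is at least 1/3. *)
Lemma var_le_low_tail A (d : nat) : (0 < d)%N ->
  (heatcorr A A).[1] - (heatcorr A A).[0] <=
  36 ^+ d * ((heatcorr A A).[36^-1] - (heatcorr A A).[0]) +
  3 * ((heatcorr A A).[1] - (heatcorr A A).[1 - (2 * d%:R)^-1]).
Proof.
move=> d0; rewrite !heatcorr_coef -!sumrB !mulr_sumr -big_split /=.
apply: ler_sum => k _.
rewrite -!mulrBr !(mulrCA _ ((heatcorr A A)`_k)) -mulrDr.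
apply: ler_wpM2l; first exact: corr_ge0.
have d1 : 1 <= d%:R :> R by rewrite ler1n.
have x1 : (2 * d%:R)^-1 <= 2^-1 :> R by rewrite lef_pV2 ?posrE; lra.
have x0 : 0 < (2 * d%:R)^-1 :> R by rewrite invr_gt0; lra.
rewrite expr1n; have [k0|k0] := eqVneq (val k) 0%N.
  by rewrite k0 !expr0 !subrr !mulr0 addr0.
rewrite expr0n (negPf k0) !subr0.
have [dk|kd] := leqP d k.
  have h1 := @pow_cutoff d k d0 dk.
  have : 0 <= 36 ^+ d * 36^-1 ^+ k :> R by rewrite mulr_ge0 ?exprn_ge0 // invr_ge0.
  lra.
have : 1 <= 36 ^+ d * 36^-1 ^+ k :> R.
  rewrite exprVn ler_pdivlMr ?exprn_gt0 // mul1r.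
  by apply: ler_weXn2l; [rewrite ler1n|exact: ltnW].
have : (1 - (2 * d%:R)^-1) ^+ k <= 1 :> R by apply: exprn_ile1; lra.
lra.
Qed.

Lemma energy_ge_var A p : 1 <= p <= 2 -> psd (1%:M - A ^t* *m A) ->
  (heatcorr A A).[1] - (heatcorr A A).[0] <= 16 * pnorm p (grad A).
Proof.
move=> hp hA.
have h : (heatcorr A A).[1] - (heatcorr A A).[0] <=
    2 * ((heatcorr A A).[1] - (heatcorr A A).[2^-1]).
  rewrite !heatcorr_coef -!sumrB mulr_sumr; apply: ler_sum => k _.
  rewrite -!mulrBr mulrCA; apply: ler_wpM2l; first exact: corr_ge0.
  rewrite expr1n; case: (val k) => [|l]; first by rewrite !expr0 !subrr mulr0.
  rewrite expr0n subr0 exprS.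
  have : 2^-1 ^+ l <= 1 :> R by apply: exprn_ile1; lra.
  lra.
have r2 : 2^-1 <= (2^-1 : R) <= 1 by apply/andP; split; lra.
have t := heat_tail hp r2 hA.
apply: (le_trans h).
have S0 := pnorm_ge0 p (grad A).
have : (1 - 2^-1) `^ (p / 2) <= 1 :> R.
  rewrite -[leRHS](powRr0 (1 - 2^-1)); apply: ger_powR.
    by apply/andP; split; lra.
  by case/andP: hp => p1 _; apply: divr_ge0; lra.
set a := _ `^ _ in t *; move=> a1.
have : 0 <= (1 - a) * pnorm p (grad A) by rewrite mulr_ge0 // subr_ge0.
lra.
Qed.

(** 36 <= 2^6 <= exp 6 and exp (-1) <= 1/2. *)
Lemma exp_cutoff d (x : R) : 6 * d%:R <= x - 1 -> 36 ^+ d * expR (- x) <= 2^-1.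
Proof.
move=> dx; have e6 : 36 <= expR 6 :> R.
  have h : 36 <= (1 + 1) ^+ 6 :> R by lra.
  rewrite -[6 in leRHS]mulr1 expRM_natl; apply: (le_trans h).
  by apply: lerXn2r; rewrite ?nnegrE ?addr_ge0 ?expR_ge0 ?expR_ge1Dx.
apply: (@le_trans _ _ (expR (x - 1) * expR (- x))).
  apply: ler_wpM2r; first exact: expR_ge0.
  apply: (@le_trans _ _ (expR 6 ^+ d)).
    by apply: lerXn2r; rewrite ?nnegrE ?expR_ge0.
  by rewrite -expRM_natl ler_expR mulrC.
rewrite -expRD addrAC subrr add0r expRN lef_pV2 ?posrE ?expR_gt0 //.
exact: expR_ge1Dx.
Qed.

Lemma cutoff_dim (x : R) : 7 <= x ->
  exists d, [/\ (0 < d)%N, 6 * d%:R <= x - 1 & 1 + x <= 8 * (2 * d%:R)].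
Proof.
move=> x7; exists (Num.truncn ((x - 1) / 6)).
set d := Num.truncn _.
have d1 : d%:R <= (x - 1) / 6 by rewrite truncn_le; lra.
have d2 : (x - 1) / 6 < d%:R + 1 by rewrite natr1; exact: truncnS_gt.
have d0 : (0 < d)%N by rewrite truncn_gt0; lra.
have d3 : 1 <= d%:R :> R by rewrite ler1n.
by move: (d%:R : R) d1 d2 d3 => y *; split=> //; lra.
Qed.

(** With d of order x the low part is at most V / 2, and what remains says that V is at most
48 (2 d)^(-p/2) S; when x is bounded the first bound on V suffices. *)
Lemma cutoff_scalar (p x V B S : R) : 1 <= p <= 2 -> 0 <= x -> 0 <= V -> 0 <= S ->
  V <= 16 * S ->
  (forall d, (0 < d)%N -> V <= 36 ^+ d * B + 24 * ((2 * d%:R)^-1 `^ (p / 2) * S)) ->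
  B <= expR (- x) * V -> V * (1 + x) `^ (p / 2) <= 384 * S.
Proof.
move=> /andP[p1 p2] x0 V0 S0 base low hB.
have q0 : 0 <= p / 2 by clear -p1; lra.
have q1 : p / 2 <= 1 by clear -p2; lra.
have [x7|x7] := ltP x 7.
  have : (1 + x) `^ (p / 2) <= 1 + x by apply: ler1_powR => //; clear -x0; lra.
  move: (_ `^ _) => y hy.
  have : V * y <= V * 8 by apply: ler_wpM2l => //; clear -x7 hy; lra.
  by clear -base S0; lra.
have [d [d0 dx xd]] := cutoff_dim x7.
have hlow : 36 ^+ d * B <= 2^-1 * V.
  apply: (@le_trans _ _ (36 ^+ d * (expR (- x) * V))).
    by apply: ler_wpM2l => //; exact: exprn_ge0.
  by rewrite mulrA; apply: ler_wpM2r => //; exact: exp_cutoff.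
have {low} := low d d0.
have : 1 <= d%:R :> R by rewrite ler1n.
move: hlow xd; move: (36 ^+ d * B) (d%:R) => u y hlow xd y1 low.
have z0 : 0 < 2 * y by clear -y1; lra.
have {hlow low} hV : V <= 48 * ((2 * y)^-1 `^ (p / 2) * S) by clear -hlow low; lra.
have : (1 + x) `^ (p / 2) <= 8 * (2 * y) `^ (p / 2).
  apply: (@le_trans _ _ ((8 * (2 * y)) `^ (p / 2))).
    by apply: ge0_ler_powR => //; rewrite nnegrE; clear -x0 y1; lra.
  rewrite powRM ?(ltW z0) //; apply: ler_wpM2r; first exact: powR_ge0.
  by apply: ler1_powR => //; rewrite ler1n.
have w0 : 0 < (2 * y) `^ (p / 2) by exact: powR_gt0.
have wV : (2 * y)^-1 `^ (p / 2) = ((2 * y) `^ (p / 2))^-1.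
  by rewrite -(powR_inv1 (ltW z0)) -powRrM mulN1r powRN.
rewrite {}wV in hV; move: ((1 + x) `^ _) ((2 * y) `^ _) w0 hV => a w w0 hV haw.
apply: (@le_trans _ _ (V * (8 * w))); first exact: ler_wpM2l.
have -> : 384 * S = 48 * (w^-1 * S) * (8 * w) by field; rewrite gt_eqF.
by apply: ler_wpM2r => //; rewrite mulr_ge0 // ltW.
Qed.

Lemma energy_ge_log A p (b : R) : 1 <= p <= 2 -> psd (1%:M - A ^t* *m A) ->
  0 < b <= 1 ->
  (heatcorr A A).[36^-1] - (heatcorr A A).[0] <=
    b * ((heatcorr A A).[1] - (heatcorr A A).[0]) ->
  ((heatcorr A A).[1] - (heatcorr A A).[0]) * (1 - ln b) `^ (p / 2) <=
  384 * pnorm p (grad A).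
Proof.
move=> hp hA /andP[b0 b1]; rewrite -{1}[b]lnK ?posrE // -{1}[ln b]opprK.
apply: cutoff_scalar => //.
- by rewrite oppr_ge0 ln_le0.
- by rewrite subr_ge0 heatcorr0_le.
- exact: pnorm_ge0.
- exact: energy_ge_var.
move=> d d0; apply: le_trans (var_le_low_tail A d0) _.
rewrite lerD2l.
have hr : 2^-1 <= 1 - (2 * d%:R : R)^-1 <= 1.
  have d1 : 1 <= d%:R :> R by rewrite ler1n.
  have x1 : (2 * d%:R)^-1 <= 2^-1 :> R by rewrite lef_pV2 ?posrE; clear -d1; lra.
  have x0 : 0 < (2 * d%:R)^-1 :> R by rewrite invr_gt0; clear -d1; lra.
  by apply/andP; split; lra.
have := heat_tail hp hr hA; rewrite subKr.
move: (pnorm _ _) (_ `^ _) (_ - _) => S w t ht.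
by clear -ht; lra.
Qed.

End Cutoff.

(** * Inequalities for the logarithmic factor *)

Section Scalars.
Variable R : realType.
Implicit Types (p v E S B b g e x y k q L : R).

Lemma powR_scale k y L q : 0 <= q <= 1 -> 1 <= k -> 0 <= y -> 0 <= L -> L <= k * y ->
  L `^ q <= k * y `^ q.
Proof.
move=> /andP[q0 q1] k1 y0 L0 h; have k0 : 0 <= k by exact: le_trans k1.
apply: (@le_trans _ _ ((k * y) `^ q)).
  by apply: ge0_ler_powR => //; rewrite nnegrE // mulr_ge0.
rewrite powRM //; apply: ler_wpM2r; first exact: powR_ge0.
exact: ler1_powR.
Qed.

(** The bracket of the theorem as a function of the sum of the squared influences. *)
Definition logfactor S : R := 1 + 2^-1 * lnp (1 / S).

Lemma logfactor_ge1 S : 1 <= logfactor S.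
Proof.
by rewrite /logfactor lerDl mulr_ge0 ?invr_ge0 // /lnp le_max lexx orbT.
Qed.

Lemma logfactor_le S v : 0 < v -> v <= 1 -> v ^+ 2 < S -> logfactor S <= 1 - ln v.
Proof.
move=> v0 v1 vS; have S0 : 0 < S by apply: lt_trans vS; rewrite exprn_gt0.
have lv : ln v <= 0 by exact: ln_le0.
have h : 2 * ln v <= ln S.
  have -> : 2 * ln v = ln (v ^+ 2) by rewrite lnXn // mulr_natl.
  by rewrite ler_ln ?posrE ?exprn_gt0 // ltW.
rewrite /logfactor /lnp div1r lnV ?posrE //.
move: (ln v) (ln S) lv h => a c a0 h.
have : Num.max (- c) 0 <= - (2 * a).
  by rewrite ge_max; apply/andP; split; clear -a0 h; lra.
move: (Num.max _ _) => z hz; clear -hz; lra.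
Qed.

(** b = S^(1/4): as S <= v^2, sqrt (S v) = b^2 sqrt v <= b v.  If S = 0 then ln (1 / S) is 0 by convention
and the Poincare inequality is enough. *)
Lemma small_influence p v E S B : 1 <= p <= 2 -> 0 <= v <= 1 -> 0 <= S -> 0 <= E ->
  v <= 16 * E ->
  (forall b, 0 < b <= 1 -> B <= b * v -> v * (1 - ln b) `^ (p / 2) <= 384 * E) ->
  B <= Num.sqrt S * Num.sqrt v -> S = 0 \/ S <= v ^+ 2 ->
  v * logfactor S `^ (p / 2) <= 768 * E.
Proof.
move=> /andP[p1 p2] /andP[v0 v1] S0 E0 base key hB hS.
have q : 0 <= p / 2 <= 1 by apply/andP; split; clear -p1 p2; lra.
have [SE|SN] := eqVneq S 0.
  rewrite /logfactor SE div1r invr0 /lnp ln0 // maxxx mulr0 addr0 powR1 mulr1.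
  by clear -base E0; lra.
case: hS => [SE|Sv]; first by rewrite SE eqxx in SN.
have Sp : 0 < S by rewrite lt_def SN.
have sv : Num.sqrt S <= v.
  by rewrite -[leRHS](ger0_norm v0) -sqrtr_sqr ler_wsqrtr.
pose b := S `^ 4^-1.
have b0 : 0 < b by exact: powR_gt0.
have bb : b ^+ 2 = Num.sqrt S.
  rewrite -powR12_sqrt // -powR_mulrn ?(ltW b0) // -powRrM; congr (_ `^ _).
  by field.
have bv : b <= Num.sqrt v.
  by rewrite -ler_sqr ?nnegrE ?sqrtr_ge0 ?(ltW b0) // bb sqr_sqrtr.
have b1 : b <= 1.
  by rewrite -ler_sqr ?nnegrE ?ler01 ?(ltW b0) // bb expr1n (le_trans sv).
have lnb : ln b = 4^-1 * ln S by rewrite ln_powR.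
have lS : ln S <= 0.
  by apply: ln_le0; apply: (le_trans Sv); apply: exprn_ile1.
have Bv : B <= b * v.
  apply: (le_trans hB); rewrite -bb expr2 -mulrA ler_wpM2l ?(ltW b0) //.
  apply: (@le_trans _ _ (Num.sqrt v * Num.sqrt v)).
    by rewrite ler_wpM2r ?sqrtr_ge0.
  by rewrite -expr2 sqr_sqrtr.
have := key b _ Bv; rewrite b0 b1 => /(_ isT); rewrite lnb => {}key.
have : logfactor S `^ (p / 2) <= 2 * (1 - 4^-1 * ln S) `^ (p / 2).
  apply: powR_scale => //.
  - by rewrite ler1n.
  - by clear -lS; lra.
  - exact: le_trans (logfactor_ge1 S).
  rewrite /logfactor /lnp div1r lnV ?posrE // max_l ?oppr_ge0 //.
  by clear -lS; lra.
move: (_ `^ _) (_ `^ _) key => x y key /(ler_wpM2l v0) h.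
by apply: (le_trans h); clear -key; lra.
Qed.

(** Here b = v^k, and 1 - ln v <= (1 - k ln v) / k because k <= 1. *)
Lemma concentrated_mean p v E S B k : 1 <= p <= 2 -> 0 < v <= 1 -> 0 <= E ->
  0 < k <= 1 ->
  (forall b, 0 < b <= 1 -> B <= b * v -> v * (1 - ln b) `^ (p / 2) <= 384 * E) ->
  B <= v `^ k * v -> v ^+ 2 < S ->
  k * (v * logfactor S `^ (p / 2)) <= 384 * E.
Proof.
move=> /andP[p1 p2] /andP[v0 v1] E0 /andP[k0 k1] key hB hS.
have q : 0 <= p / 2 <= 1 by apply/andP; split; clear -p1 p2; lra.
have b0 : 0 < v `^ k by exact: powR_gt0.
have b1 : v `^ k <= 1.
  by rewrite -[leRHS](powRr0 v); apply: ger_powR; [rewrite v0|exact: ltW].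
have := key _ _ hB; rewrite b0 b1 => /(_ isT); rewrite ln_powR => {}key.
have lv : ln v <= 0 by exact: ln_le0.
have kl : k * ln v <= 0 by rewrite mulr_ge0_le0 // ltW.
have L1 := logfactor_ge1 S.
have : logfactor S `^ (p / 2) <= k^-1 * (1 - k * ln v) `^ (p / 2).
  apply: powR_scale => //.
  - by rewrite invf_ge1.
  - by clear -kl; lra.
  - exact: le_trans L1.
  rewrite mulrBr mulKf ?gt_eqF // mulr1.
  apply: (le_trans (logfactor_le v0 v1 hS)).
  by rewrite lerD2r invf_ge1.
move: (_ `^ _) (_ `^ _) key => x y key h.
apply: le_trans key.
rewrite mulrCA; apply: ler_wpM2l; first exact: ltW.
have := ler_wpM2l (ltW k0) h; rewrite mulVKf ?gt_eqF //.
Qed.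

(** Taking x = e / 2 in the last hypothesis gives (e / 2)^p <= E, hence v^(p (1/2 + (2 - p)/8)) <= 64 E.
The exponent is 1 - a with a >= (2 - p)/4, and v^a (1 - a ln v) <= 1 turns the
remaining power of v into the logarithm at the price of 1 / a. *)
Lemma spread_mean p v E S g e : 1 <= p < 2 -> 0 < v <= 1 -> 0 <= E ->
  v ^+ 2 < S -> v `^ (2^-1 + (2 - p) / 8) <= g -> g <= 4 * e ->
  (forall x, 0 < x -> e <= x + x `^ (1 - p) * E) ->
  (2 - p) * (v * logfactor S `^ (p / 2)) <= 3072 * E.
Proof.
move=> /andP[p1 p2] /andP[v0 v1] E0 hS hg ge split.
have p0 : 0 <= p by clear -p1; lra.
set d := (2 - p) / 8 in hg *.
set w := v `^ (2^-1 + d) in hg.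
have w0 : 0 < w by exact: powR_gt0.
have e0 : 0 < e / 2 by clear -w0 hg ge; lra.
have hE : (e / 2) `^ p <= E.
  have := split _ e0.
  have -> : (e / 2) `^ p = (e / 2) * (e / 2) `^ (p - 1).
    by rewrite mulr_powRB1 ?(ltW e0) //; clear -p1; lra.
  have -> : (e / 2) `^ (1 - p) = ((e / 2) `^ (p - 1))^-1 by rewrite -powRN opprB.
  have u0 : 0 < (e / 2) `^ (p - 1) by exact: powR_gt0.
  move: (_ `^ _) u0 => u u0 h.
  rewrite -ler_pdivlMr // mulrC; clear -h; lra.
have wE : w `^ p <= 64 * E.
  have h8 : w <= 8 * (e / 2) by clear -hg ge; lra.
  apply: (@le_trans _ _ ((8 * (e / 2)) `^ p)).
    by apply: ge0_ler_powR => //; rewrite nnegrE ltW // mulr_gt0.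
  rewrite powRM ?(ltW e0) //; apply: ler_pM => //; try exact: powR_ge0.
  have -> : 64 = 8 `^ 2 :> R by rewrite (powR_mulrn 2) //; ring.
  by apply: ler_powR; [rewrite ler1n|exact: ltW].
pose a := 1 - p * (2^-1 + d).
have a4 : (2 - p) / 4 <= a.
  rewrite /a /d -subr_ge0.
  have -> : 1 - p * (2^-1 + (2 - p) / 8) - (2 - p) / 4 = (2 - p) * (2 - p) / 8 by field.
  by rewrite !mulr_ge0 ?subr_ge0 ?ltW.
have a0 : 0 < a by apply: lt_le_trans a4; clear -p2; lra.
have d0 : 0 <= d by rewrite /d; clear -p2; lra.
have a1 : a <= 1.
  by rewrite /a gerBl mulr_ge0 ?addr_ge0 //; clear -p1; lra.
have vE : v = w `^ p * v `^ a.
  rewrite /w -powRrM -powRD; last by rewrite (gt_eqF v0) implybT.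
  by rewrite /a (mulrC _ p) addrC subrK powRr1 // ltW.
have L1 := logfactor_ge1 S.
have LL : logfactor S `^ (p / 2) <= logfactor S.
  by apply: ler1_powR => //; clear -p2; lra.
have Lv := logfactor_le v0 v1 hS.
have lv : ln v <= 0 by exact: ln_le0.
have ex : v `^ a * (1 - a * ln v) <= 1.
  have := expR_ge1Dx (- (a * ln v)).
  have -> : v `^ a = expR (a * ln v) by rewrite /powR (gt_eqF v0).
  move=> h; apply: (@le_trans _ _ (expR (a * ln v) * expR (- (a * ln v)))).
    by apply: ler_wpM2l; first exact: expR_ge0.
  by rewrite expRxMexpNx_1.
have fin : a * (v `^ a * logfactor S `^ (p / 2)) <= 1.
  apply: le_trans ex; rewrite mulrCA; apply: ler_wpM2l; first exact: powR_ge0.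
  apply: (@le_trans _ _ (a * (1 - ln v))).
    by apply: ler_wpM2l; [exact: ltW|exact: le_trans Lv].
  by rewrite mulrBr mulr1 lerD2r.
have z0 : 0 <= v `^ a * logfactor S `^ (p / 2) by rewrite mulr_ge0 ?powR_ge0.
rewrite {1}vE -mulrA.
move: (v `^ a * _) (w `^ p) z0 fin wE (powR_ge0 w p) => z t z0 fin tE t0.
have h1 : (2 - p) * z <= 4.
  have : (2 - p) / 4 * z <= a * z by rewrite ler_wpM2r.
  by clear -fin; lra.
rewrite mulrCA; apply: (@le_trans _ _ (t * 4)); first by rewrite ler_wpM2l.
by clear -tE E0; lra.
Qed.

End Scalars.

(** * The two inequalities with normalised quantities *)

Section Main.
Variables (R : realType) (C : cplx R) (n : nat).
Local Notation M := 'M[C]_(qdim n).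
Implicit Types (A X : M) (p r : R).

Definition rentr X : R := re ((2 ^+ n)^-1 * \tr X).

Lemma rentrE X : rentr X = (2 ^+ n)^-1 * retr X.
Proof. by rewrite /rentr -reZ fmorphV rmorphXn rmorph_nat. Qed.

Definition nenergy p A : R := (2 ^+ n)^-1 * pnorm p (grad A).
Definition nvariance A : R := (2 ^+ n)^-1 * sqnorm (A - heat 0 A).
Definition ninfluence A : R := \sum_(j < n) ((2 ^+ n)^-1 * tnorm (single (grad A j))) ^+ 2.

Local Notation N := (2 ^+ n : R).

Lemma dim_gt0 : 0 < N. Proof. by rewrite exprn_gt0. Qed.

Lemma sqnorm_centre A : sqnorm (A - heat 0 A) = (heatcorr A A).[1] - (heatcorr A A).[0].
Proof. by rewrite -heatcorr_centre heatcorrE /heat smooth1r. Qed.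

Lemma nenergy_ge0 p A : 0 <= nenergy p A.
Proof. by rewrite mulr_ge0 ?pnorm_ge0 // invr_ge0 ltW ?dim_gt0. Qed.

Lemma nvariance_ge0 A : 0 <= nvariance A.
Proof. by rewrite mulr_ge0 ?sqnorm_ge0 // invr_ge0 ltW ?dim_gt0. Qed.

Lemma ninfluence_ge0 A : 0 <= ninfluence A.
Proof. by apply: sumr_ge0 => j _; exact: sqr_ge0. Qed.

Lemma retr_psd X : psd X -> 0 <= retr X.
Proof.
move=> h; rewrite -(sum_quad_eigvec X (spectral_unitarymx X)).
by apply: sumr_ge0 => i _; exact: h.
Qed.

Lemma retr_id : retr (1%:M : M) = N.
Proof. by rewrite retr1 qdimE natrX. Qed.

Lemma nvariance_le1 A : psd (1%:M - A ^t* *m A) -> nvariance A <= 1.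
Proof.
move=> /retr_psd; rewrite retrB retr_id subr_ge0 => h.
rewrite /nvariance mulrC ler_pdivrMr ?dim_gt0 // mul1r; apply: le_trans h.
rewrite sqnorm_centre heatcorrE /heat smooth1r gerBl.
exact: heatcorr_ge0.
Qed.

Lemma energy_log A p b : 1 <= p <= 2 -> psd (1%:M - A ^t* *m A) -> 0 < b <= 1 ->
  N^-1 * ((heatcorr A A).[36^-1] - (heatcorr A A).[0]) <= b * nvariance A ->
  nvariance A * (1 - ln b) `^ (p / 2) <= 384 * nenergy p A.
Proof.
move=> hp hA hb; rewrite /nvariance /nenergy sqnorm_centre mulrCA ler_pM2l ?invr_gt0 ?dim_gt0 // => hB.
have := energy_ge_log hp hA hb hB.
by rewrite -[in X in _ -> X]mulrA [384 * (_ * _)]mulrCA ler_pM2l ?invr_gt0 ?dim_gt0.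
Qed.

Lemma energy_var A p : 1 <= p <= 2 -> psd (1%:M - A ^t* *m A) -> nvariance A <= 16 * nenergy p A.
Proof.
move=> hp hA; rewrite /nvariance /nenergy sqnorm_centre mulrCA ler_pM2l ?invr_gt0 ?dim_gt0 //.
exact: energy_ge_var.
Qed.

Lemma low_influence A :
  N^-1 * ((heatcorr A A).[36^-1] - (heatcorr A A).[0]) <= Num.sqrt (ninfluence A) * Num.sqrt (nvariance A).
Proof.
have N0 := dim_gt0; have h := low_le_influence A; rewrite -sqnorm_centre in h.
have -> : ninfluence A = (N^-1) ^+ 2 * \sum_j tnorm (single (grad A j)) ^+ 2.
  by rewrite mulr_sumr; apply: eq_bigr => j _; rewrite exprMn.
have i0 : 0 <= N^-1 by rewrite invr_ge0 ltW.
rewrite /nvariance sqrtrM ?sqr_ge0 // sqrtr_sqr ger0_norm // [Num.sqrt (N^-1 * _)]sqrtrM //.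
rewrite sqrtrV ?(ltW N0) // -mulrA ler_pM2l ?invr_gt0 //.
have s0 : 0 < Num.sqrt N by rewrite sqrtr_gt0.
by rewrite mulrCA mulrC ler_pdivlMr // mulrC.
Qed.

Lemma low_tnorm A :
  N^-1 * ((heatcorr A A).[36^-1] - (heatcorr A A).[0]) <=
  N^-1 * tnorm (single (A - heat 0 A)) * Num.sqrt (nvariance A).
Proof.
have N0 := dim_gt0; rewrite -mulrA ler_pM2l ?invr_gt0 //.
have s0 : 0 < Num.sqrt N by rewrite sqrtr_gt0.
have h := heat_hyper (A - heat 0 A); rewrite heatcorr_centre in h.
rewrite /nvariance sqrtrM ?invr_ge0 ?(ltW N0) // sqrtrV ?(ltW N0) //.
rewrite mulrCA mulrC ler_pdivlMr // mulrC; apply: le_trans h.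
apply: ler_wpM2l; first exact: ltW.
rewrite lerD2r !heatcorr_coef; apply: ler_sum => k _.
apply: ler_wpM2l; first exact: corr_ge0.
by apply: lerXn2r; rewrite ?nnegrE ?invr_ge0 // lef_pV2 ?posrE // ler_nat.
Qed.

(** This spares Jensen's inequality in comparing |grad A| in the norms 1 and p. *)
Lemma pow_split (p g x : R) : 1 <= p -> 0 <= g -> 0 < x -> g <= x + x `^ (1 - p) * g `^ p.
Proof.
move=> p1 g0 x0; have [gx|xg] := leP g x.
  by apply: (le_trans gx); rewrite lerDl mulr_ge0 ?powR_ge0.
have gp : 0 < g by exact: lt_trans xg.
have -> : g `^ p = g * g `^ (p - 1) by rewrite mulr_powRB1 //; exact: lt_le_trans p1.
have -> : x `^ (1 - p) = (x `^ (p - 1))^-1 by rewrite -powRN opprB.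
have : x `^ (p - 1) <= g `^ (p - 1).
  by apply: ge0_ler_powR; rewrite ?nnegrE ?subr_ge0 // ltW.
have := powR_gt0 (p - 1) x0.
move: (x `^ _) (g `^ _) => u w u0 uw.
have : g <= u^-1 * (g * w).
  by rewrite mulrC ler_pdivlMr // ler_wpM2l.
by move=> h; apply: (le_trans h); rewrite lerDr ltW.
Qed.

Lemma tnorm_split A p x : 1 <= p -> 0 < x ->
  N^-1 * tnorm (grad A) <= x + x `^ (1 - p) * nenergy p A.
Proof.
move=> p1 x0; have N0 := dim_gt0; have Nn : N != 0 by rewrite gt_eqF.
rewrite /nenergy mulrCA -[x in x + _](mulKf Nn) -mulrDr.
rewrite ler_pM2l ?invr_gt0 // /tnorm /pnorm mulr_sumr.
have -> : N * x = \sum_(i < qdim n) x.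
  by rewrite sumr_const card_ord -[_ *+ qdim n]mulr_natl qdimE natrX.
rewrite -big_split; apply: ler_sum => i _ /=.
by apply: pow_split => //; exact: singv_ge0.
Qed.

Theorem eldan_gross_bounded A p : 1 <= p < 2 -> psd (1%:M - A ^t* *m A) ->
  (2 - p) * (nvariance A * logfactor (ninfluence A) `^ (p / 2)) <= 3072 * nenergy p A.
Proof.
move=> hp hA; have /andP[p1 p2] := hp.
have hp' : 1 <= p <= 2 by rewrite p1 ltW.
have E0 := nenergy_ge0 p A; have S0 := ninfluence_ge0 A; have v0 := nvariance_ge0 A; have v1 := nvariance_le1 hA.
have [vz|vN] := eqVneq (nvariance A) 0.
  by rewrite vz mul0r mulr0; exact: mulr_ge0 (ler0n _ _) E0.
have vp : 0 < nvariance A by rewrite lt_def vN.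
have [Sv|vS] := leP (ninfluence A) (nvariance A ^+ 2).
  have h : nvariance A * logfactor (ninfluence A) `^ (p / 2) <= 768 * nenergy p A.
    apply: (small_influence hp' _ S0 E0 (energy_var hp' hA) _ (low_influence A)).
    - by rewrite v0.
    - by move=> b; exact: energy_log.
    by right.
  have z0 : 0 <= nvariance A * logfactor (ninfluence A) `^ (p / 2) by rewrite mulr_ge0 ?powR_ge0.
  have := ler_wpM2r z0 (_ : 2 - p <= 1).
  move: (nvariance A * _) h z0 => z h z0 /(_ ltac:(lra)).
  by clear -h E0; lra.
have [hg|hg] := leP (N^-1 * tnorm (single (A - heat 0 A))) (nvariance A `^ (2^-1 + (2 - p) / 8)).
  have h : (2 - p) / 8 * (nvariance A * logfactor (ninfluence A) `^ (p / 2)) <= 384 * nenergy p A.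
    apply: (concentrated_mean hp' _ E0 _ (fun b => energy_log hp' hA)) => //.
    - by rewrite vp.
    - by apply/andP; split; clear -p1 p2; lra.
    apply: (le_trans (low_tnorm A)).
    apply: (@le_trans _ _ (nvariance A `^ (2^-1 + (2 - p) / 8) * Num.sqrt (nvariance A))).
      by rewrite ler_wpM2r ?sqrtr_ge0.
    rewrite -powR12_sqrt // -powRD; last by rewrite vN implybT.
    rewrite -{3}[nvariance A]powRr1 // -powRD; last by rewrite vN implybT.
    have -> : 2^-1 + (2 - p) / 8 + 2^-1 = (2 - p) / 8 + 1 :> R by field.
    by [].
  by move: (nvariance A * _) h => z h; clear -h; lra.
apply: (@spread_mean _ _ _ _ _ (N^-1 * tnorm (single (A - heat 0 A))) (N^-1 * tnorm (grad A))) => //.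
- by rewrite vp.
- exact: ltW.
- by rewrite mulrCA ler_pM2l ?invr_gt0 ?dim_gt0 //; exact: l1_poincare.
by move=> x x0; exact: tnorm_split.
Qed.

(** With t = tau(A), A^2 = 1 gives (A - t)^2 = (1 - t A)^2, and 1 - t A >= 0 because |t| <= 1; so
|A - t| = 1 - t A, whose trace is that of (A - t)^2. *)
Lemma boolean_tnorm A : A ^t* = A -> A *m A = 1%:M ->
  tnorm (single (A - heat 0 A)) = sqnorm (A - heat 0 A).
Proof.
move=> Ac AA; set t := (2 ^+ n)^-1 * retr A.
have N0 := dim_gt0.
have tE : heat 0 A = t%:K *: 1%:M.
  rewrite heat0E scalemx1; congr (_%:M); rewrite /t rmorphM fmorphV rmorphXn rmorph_nat /=.
  congr (_ * _); rewrite /retr reE; apply/esym/Creal_ReP/CrealP.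
  by rewrite -[in RHS]Ac trace_map_mx mxtrace_tr.
have t1 : t ^+ 2 <= 1.
  have := cauchy_schwarz1 (1%:M : M) A.
  rewrite ct1 !mul1mx Ac AA retr_id /t exprMn => h.
  by rewrite exprVn mulrC ler_pdivrMr ?exprn_gt0 // mul1r expr2.
have t2 : -1 <= t <= 1.
  by rewrite -ler_norml -(expr_le1 (n := 2)) // real_normK ?num_real.
pose H : M := 1%:M - t%:K *: A.
have Hc : H ^t* = H by rewrite /H ctB ctZ ct1 Ac.
have HH : H *m H = (A - heat 0 A) ^t* *m (A - heat 0 A).
  rewrite tE /H ctB ctZ ct1 Ac !mulmxBl !mulmxBr -!scalemxAl -!scalemxAr !mulmx1 !mul1mx AA.
  by mxring.
have Hp : psd H.
  have -> : H = ((1 - t) / 4)%:K *: ((1%:M + A) ^t* *m (1%:M + A)) +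
                ((1 + t) / 4)%:K *: ((1%:M - A) ^t* *m (1%:M - A)).
    rewrite ctD ctB ct1 Ac !mulmxBl !mulmxDl !mulmxBr !mulmxDr !mulmx1 !mul1mx AA /H.
    by apply/matrixP => ? ?; rewrite ?(addmxE, oppmxE, scalemxE); field.
  case/andP: t2 => ta tb.
  by apply: psdD; apply: psdZ; rewrite ?divr_ge0 ?subr_ge0 //; try exact: psd_sq; lra.
rewrite (tnorm_unique Hp Hc HH) /sqnorm -HH /H.
rewrite !mulmxBl !mulmxBr -!scalemxAl -!scalemxAr !mulmx1 !mul1mx AA.
rewrite !(retrB, retrZ) retr_id.
have -> : retr A = N * t by rewrite /t mulVKf // gt_eqF.
by ring.
Qed.

Theorem eldan_gross_boolean A p : 1 <= p <= 2 -> A ^t* = A -> A *m A = 1%:M ->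
  nvariance A * logfactor (ninfluence A) `^ (p / 2) <= 768 * nenergy p A.
Proof.
move=> hp Ac AA; have /andP[p1 p2] := hp.
have hA : psd (1%:M - A ^t* *m A) by rewrite Ac AA subrr; exact: psd0.
have E0 := nenergy_ge0 p A; have S0 := ninfluence_ge0 A; have v0 := nvariance_ge0 A; have v1 := nvariance_le1 hA.
have [vz|vN] := eqVneq (nvariance A) 0.
  by rewrite vz mul0r; exact: mulr_ge0 (ler0n _ _) E0.
have vp : 0 < nvariance A by rewrite lt_def vN.
have [Sv|vS] := leP (ninfluence A) (nvariance A ^+ 2).
  apply: (small_influence hp _ S0 E0 (energy_var hp hA) _ (low_influence A)).
  - by rewrite v0.
  - by move=> b; exact: energy_log.
  by right.
have h : 2^-1 * (nvariance A * logfactor (ninfluence A) `^ (p / 2)) <= 384 * nenergy p A.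
  apply: (concentrated_mean hp _ E0 _ (fun b => energy_log hp hA)) => //.
  - by rewrite vp.
  - by apply/andP; split; lra.
  apply: (le_trans (low_tnorm A)).
  by rewrite boolean_tnorm // -/(nvariance A) powR12_sqrt // mulrC.
by move: (nvariance A * _) h => z h; clear -h; lra.
Qed.

End Main.

(** * Translation to complex matrices over the reals *)

Section Bridge.
Variable R : realType.

Definition Rcplx : cplx R :=
  @Cplx R R[i] (@complex.Re R) (real_complex R) (@complexRe R) (fun _ => erefl).

Variable n : nat.
Local Notation M := 'M[Rcplx]_(qdim n).
Implicit Types (A X : qmx R n) (p r : R).

Lemma hermfunE m (f : R -> R) (H : 'M[Rcplx]_m) : hermfun f H = hfun (C := Rcplx) f H.
Proof. reflexivity. Qed.

Lemma absmxE m (H : 'M[Rcplx]_m) : absmx H = habs (C := Rcplx) H.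
Proof. reflexivity. Qed.

Lemma tauE j A : tau j A = cexp j (A : M).
Proof.
apply: (@ent_inj _ Rcplx) => x y.
by rewrite ent_cexp -[LHS]/(entry (tau j A) x y) entry_qmx_of.
Qed.

Lemma ddE j A : dd j A = cdif j (A : M).
Proof. by rewrite cdifE /dd tauE. Qed.

Lemma lpnormE p A : lpnorm p A =
  ((2 ^+ n)^-1 * \sum_i singv (single (A : M)) i `^ p) `^ p^-1.
Proof.
rewrite -(retr_hfun_habs (fun t => t `^ p)) -rentrE.
reflexivity.
Qed.

Lemma energyE p A : 1 <= p -> energy p A = nenergy p (A : M).
Proof.
move=> p1; have p0 : p != 0 by rewrite gt_eqF // (lt_le_trans ltr01 p1).
rewrite /energy.
have -> : gradabs A = hfun (C := Rcplx) Num.sqrt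
    (\sum_j habs (C := Rcplx) (grad (A : M) j) *m habs (C := Rcplx) (grad (A : M) j)).
  rewrite /gradabs hermfunE; apply: (congr1 (hfun (C := Rcplx) Num.sqrt)).
  apply: eq_bigr => j _.
  by rewrite absmxE ddE.
rewrite -[lpnorm _ _]/((rentr (C := Rcplx) (hfun (C := Rcplx) (fun t => t `^ p)
   (habs (C := Rcplx) _))) `^ p^-1).
rewrite -powRrM mulVf // rentrE retr_hfun_habs_grad -/(pnorm p _) -/(nenergy p (A : M)).
by rewrite powRr1 // nenergy_ge0.
Qed.

Lemma influence1E j A : influence1 j A = (2 ^+ n)^-1 * tnorm (single (grad (A : M) j)).
Proof.
rewrite /influence1 ddE lpnormE invr1 powRr1.
  by congr (_ * _); apply: eq_bigr => i _; rewrite powRr1 // singv_ge0.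
by rewrite mulr_ge0 ?invr_ge0 ?exprn_ge0 // sumr_ge0 // => i _; exact: powR_ge0.
Qed.

Lemma varianceE A : Defs.variance A = nvariance (A : M).
Proof.
rewrite /Defs.variance -[ntr A]/((2 ^+ n)^-1 * \tr A) -(heat0E (A : M)) lpnormE.
rewrite -powR_mulrn ?powR_ge0 // -powRrM mulVf ?pnatr_eq0 // powRr1; last first.
  by rewrite mulr_ge0 ?invr_ge0 ?exprn_ge0 // sumr_ge0 // => i _; exact: powR_ge0.
rewrite /nvariance /sqnorm -gram1 -sum_singv_sq; congr (_ * _); apply: eq_bigr => i _.
by rewrite (powR_mulrn 2) // singv_ge0.
Qed.

Lemma sum_influenceE A : \sum_(j < n) influence1 j A ^+ 2 = ninfluence (A : M).
Proof. by apply: eq_bigr => j _; rewrite influence1E. Qed.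

Lemma talagrand_rhsE K p A :
  talagrand_rhs K p A = K * nvariance (A : M) * logfactor (ninfluence (A : M)) `^ (p / 2).
Proof. by rewrite /talagrand_rhs varianceE sum_influenceE. Qed.

Lemma opnorm_psd A : opnorm A <= 1 -> psd (C := Rcplx) (1%:M - (A : M) ^t* *m (A : M)).
Proof. move=> h; apply: psd_opnorm; exact: h. Qed.

End Bridge.

Theorem corollary4p3 (R : realType) :
  exists (c : R) (C C' : R -> R),
    [/\ 0 < c,
        forall p : R, 1 <= p < 2 -> 0 < C p /\ c * (2 - p) <= C p,
        forall p : R, 1 <= p <= 2 -> 0 < C' p /\ c <= C' p &
        forall n : nat, (1 <= n)%N ->
          (forall A : qmx R n, opnorm A <= 1 ->
             forall p : R, 1 <= p < 2 ->
               energy p A >= talagrand_rhs (C p) p A)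
          /\
          (forall A : qmx R n, quantum_boolean A ->
             forall p : R, 1 <= p <= 2 ->
               energy p A >= talagrand_rhs (C' p) p A)].
Proof.
have [c [c0 cE]] : exists c : R, 0 < c /\ c * 3072 = 1.
  by exists 3072^-1; rewrite invr_gt0 ltr0n mulVf ?pnatr_eq0.
have scale (x y : R) : x <= 3072 * y -> c * x <= y.
  by move=> /(ler_wpM2l (ltW c0)); rewrite mulrA cE mul1r.
exists c, (fun p => c * (2 - p)), (fun=> c); split.
- exact: c0.
- by move=> p /andP[_ p2]; rewrite mulr_gt0 ?subr_gt0.
- by move=> p _; rewrite lexx.
move=> n _; split=> A hA p hp; have [p1 _] := andP hp;
  rewrite energyE // talagrand_rhsE -mulrA.
  rewrite -mulrA; apply: scale.
  exact: (@eldan_gross_bounded _ (Rcplx R) n A p hp (opnorm_psd hA)).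
case: hA => Ac AA; apply: scale.
apply: (le_trans (@eldan_gross_boolean _ (Rcplx R) n A p hp Ac AA)).
by apply: ler_wpM2r; [exact: nenergy_ge0|rewrite ler_nat].
Qed.
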